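(* Let $G$ and $H$ be graphs. The Cartesian product $G\times H$ is simply polytopal if and only if both $G$ and $H$ are simply polytopal.
   Context: Graphs are finite, simple and nonempty. A polytope is the convex hull of finitely many points in some $\mathbb{R}^N$; a $d$-polytope is a polytope of dimension $d$. The graph of a polytope is the abstract graph formed by its vertices and edges. A $d$-polytope is simple if all its vertex figures are simplices, equivalently if each vertex is contained in exactly $d$ edges (so a point is a simple $0$-polytope). A graph is simply $d$-polytopal if it is isomorphic to the graph of a simple $d$-polytope, and simply polytopal if it is simply $d$-polytopal for some $d$. The Cartesian product $G\times H$ has vertex set $V(G)\times V(H)$, and $(a,b)$, $(c,e)$ are adjacent if and only if either $a=c$ and $\{b,e\}\in E(H)$, or $b=e$ and $\{a,c\}\in E(G)$. *)

(* Defs.v *)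
From HB Require Import structures.
From mathcomp Require Import all_boot all_order all_algebra.
From mathcomp Require Import all_classical all_reals.

Set Implicit Arguments.
Unset Strict Implicit.
Unset Printing Implicit Defensive.

Import Order.TTheory GRing.Theory Num.Theory.

Local Open Scope classical_set_scope.
Local Open Scope ring_scope.

Record sgraph := SGraph {
  gvertex :> finType;
  gadj : rel gvertex;
  gadj_sym : symmetric gadj;
  gadj_irr : irreflexive gadj;
  gvertex_gt0 : (0 < #|gvertex|)%N }.

Section CartesianProduct.
Variables G H : sgraph.

Definition cprod_adj : rel (G * H)%type := fun x y =>
  ((x.1 == y.1) && gadj x.2 y.2) || ((x.2 == y.2) && gadj x.1 y.1).

Lemma cprod_adj_sym : symmetric cprod_adj.
Proof.
move=> x y; rewrite /cprod_adj (eq_sym x.1) (eq_sym x.2).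
by rewrite (gadj_sym x.2) (gadj_sym x.1).
Qed.

Lemma cprod_adj_irr : irreflexive cprod_adj.
Proof. by move=> x; rewrite /cprod_adj !gadj_irr !andbF. Qed.

Lemma cprod_gt0 : (0 < #|{: G * H}|)%N.
Proof. by rewrite card_prod muln_gt0 !gvertex_gt0. Qed.

Definition cprod : sgraph := SGraph cprod_adj_sym cprod_adj_irr cprod_gt0.

End CartesianProduct.

Section Polytopes.
Variables (R : realType) (N : nat).
Implicit Types (A P F : set 'rV[R]_N) (u v : 'rV[R]_N).

Definition convex_hull A : set 'rV[R]_N :=
  [set x | exists (n : nat) (w : 'I_n -> R) (p : 'I_n -> 'rV[R]_N),
    [/\ forall i, A (p i), forall i, 0 <= w i, \sum_i w i = 1 &
        x = \sum_i w i *: p i]].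

Definition affine_hull A : set 'rV[R]_N :=
  [set x | exists (n : nat) (w : 'I_n -> R) (p : 'I_n -> 'rV[R]_N),
    [/\ forall i, A (p i), \sum_i w i = 1 & x = \sum_i w i *: p i]].

(* The empty set has no dimension in this sense. *)
Definition has_dim A (d : nat) : Prop :=
  exists (x : 'rV[R]_N) (U : {vspace 'rV[R]_N}),
    affine_hull A = [set y | y - x \in U] /\ \dim U = d.

Definition is_polytope P : Prop :=
  exists A, finite_set A /\ P = convex_hull A.

Definition is_dpolytope (d : nat) P : Prop := is_polytope P /\ has_dim P d.

(* A face is cut out by a valid inequality x *m a <= c; for a = 0 this gives
   the improper faces P (c = 0) and set0 (c > 0). *)
Definition is_face P F : Prop :=
  exists (a : 'cV[R]_N) (c : R),
    (forall x, P x -> (x *m a) 0 0 <= c) /\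
    F = [set x | P x /\ (x *m a) 0 0 = c].

Definition is_vertex P v : Prop := is_face P [set v].

Definition is_edge P F : Prop := is_face P F /\ has_dim F 1.

Definition edge_joins P u v : Prop :=
  [/\ is_vertex P u, is_vertex P v, u <> v &
      exists F, [/\ is_edge P F, F u & F v]].

Definition is_simple_dpolytope (d : nat) P : Prop :=
  is_dpolytope d P /\
  forall v, is_vertex P v -> ([set F | is_edge P F /\ F v] #= `I_d)%card.

Definition isomorphic_to_polytope_graph (G : sgraph) P : Prop :=
  exists f : G -> 'rV[R]_N,
    set_bij [set: G] [set v | is_vertex P v] f /\
    forall x y : G, gadj x y <-> edge_joins P (f x) (f y).

End Polytopes.

Definition simply_dpolytopal (R : realType) (d : nat) (G : sgraph) : Prop :=
  exists (N : nat) (P : set 'rV[R]_N),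
    is_simple_dpolytope d P /\ isomorphic_to_polytope_graph G P.

Definition simply_polytopal (R : realType) (G : sgraph) : Prop :=
  exists d : nat, simply_dpolytopal R d G.

(* Main.v *)
Require Import Defs.
From mathcomp Require Import all_boot all_order all_algebra.
From mathcomp Require Import all_classical all_reals.
From mathcomp Require Import ring lra.

(** If P and Q are simple, so is their product: its nonempty faces are the
    products of nonempty faces of P and Q, so its graph is the Cartesian
    product, and dimensions and degrees add ([simply_polytopal_cprod]).

    Conversely, let P be a simple polytope whose graph is the product of G and
    H.  Of the geometry of P only a few combinatorial facts are needed, about
    the family of vertex sets of faces ([face_system]): any set of edges at a
    vertex spans a face containing no further edge at that vertex; a face is
    determined by one of its vertices and its edges there; faces are regular
    graphs; and every vertex is the unique maximum of an injective function
    whose local maxima on a face are global on that face.  They are proved in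
    [vertex_face_system].

    The heart is to show that a G-edge and an H-edge at a common vertex span a
    2-face which is the obvious square ([opposite_corner]).  Count the mixed
    corners of 2-faces, those formed by a G-edge and an H-edge.  A 2-face is
    2-regular, so by the handshake lemma its mixed corners come in pairs in
    every row and every column; hence a 2-face with a mixed corner has at least
    four.  On the other hand let phi be one of the functions above.  For at
    least a quarter of all mixed corners the apex is no lower than the ends of
    its two edges; such an apex is the top of the 2-face spanned there, so these
    corners span distinct 2-faces.  The two bounds force equality: a
    2-face with mixed corners has exactly four, and its top is one of them.  As
    phi can be chosen to peak at any vertex, all vertices of such a 2-face are
    mixed corners, and the 2-face is a square.

    Consequently the face spanned by the G-edges at a vertex contains no
    H-edge at any of the vertices reached by G-edges, so its vertices are
    exactly a fiber of the second projection ([fiber_face]); being a face of a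
    simple polytope, it is a simple polytope, with graph G
    ([vertex_face_polytopal]).

    The geometric input rests on Farkas' lemma ([farkas]), which gives that a
    polytope lies in the cone spanned at any vertex by the edges
    ([vertex_cone]).  For a simple polytope these edges are as many as the
    dimension, hence linearly independent, and functionals can be prescribed on
    them freely. *)

Set Implicit Arguments.
Unset Strict Implicit.
Unset Printing Implicit Defensive.

Import Order.TTheory GRing.Theory Num.Theory.

Local Open Scope ring_scope.

(** * Face systems on graphs *)

Definition nbrs (X : sgraph) (x : X) : {set X} := [set y | gadj x y].

(** Orienting edges upwards along [phi], this says that every face has a unique
    sink; linear functionals on a polytope have this property. *)
Definition unimodal (R : realType) (X : sgraph) (FF : {set {set X}})
    (phi : X -> R) : Prop :=
  forall S y, S \in FF -> y \in S ->
    (forall u, u \in nbrs y :&: S -> phi u <= phi y) ->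
    forall z, z \in S -> phi z <= phi y.

(** What the combinatorial argument uses about the vertex sets of the faces of a
    simple polytope with graph [X]; for those, [fs_sink] comes from a functional
    that exposes the vertex [x], perturbed into general position. *)
Record face_system (R : realType) (X : sgraph) (FF : {set {set X}}) : Prop :=
  FaceSystem {
    fs_span : forall x (I : {set X}), I \subset nbrs x ->
      exists S, [/\ S \in FF, x \in S & nbrs x :&: S = I];
    fs_subset : forall S S' x, S \in FF -> S' \in FF -> x \in S -> x \in S' ->
      nbrs x :&: S \subset S' -> S \subset S';
    fs_regular : forall S x y, S \in FF -> x \in S -> y \in S ->
      #|nbrs x :&: S| = #|nbrs y :&: S|;
    fs_sink : forall x, exists phi : X -> R,
      [/\ injective phi, forall z, phi z <= phi x & unimodal FF phi];
    fs_whole : [set: X] \in FF }.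

Section Connected.
Import mathcomp.boot.fintype mathcomp.boot.finset.

(** Faces are connected: take [phi] peaking at a vertex [z] of [S].  The highest
    vertex of [D] is a local maximum on [S], hence it is [z]. *)
Lemma face_connected (R : realType) (X : sgraph) (FF : {set {set X}})
    (S D : {set X}) :
  face_system R FF -> S \in FF -> D \subset S -> (exists x, x \in D) ->
  (forall y u, y \in D -> u \in nbrs y :&: S -> u \in D) -> S \subset D.
Proof.
move=> FFP FS sDS [x0 Dx0] closedD; apply/subsetP => z Sz.
have [phi [phi_inj phi_max sink]] := fs_sink FFP z.
have [y Dy ymax] := @arg_maxP _ _ X x0 (mem D) phi Dx0.
suff /phi_inj -> : phi z = phi y by [].
apply/le_anti; rewrite phi_max andbT.
apply: (sink _ _ FS (subsetP sDS y Dy)) => // u Su.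
exact/ymax/(closedD y).
Qed.

End Connected.

(** * Parity of degrees *)

Section Handshake.
Import mathcomp.boot.fintype mathcomp.boot.finset.
Variables (T : finType) (e : rel T).
Hypotheses (e_sym : symmetric e) (e_irr : irreflexive e).

(** Adding a vertex to the list counts each of its new edges twice. *)
Lemma odd_degree_sum (K : {set T}) :
  odd (\sum_(x in K) #|[set y in K | e x y]|) = false.
Proof.
have -> : (\sum_(x in K) #|[set y in K | e x y]|
           = \sum_(x <- enum K) \sum_(y <- enum K) e x y)%N.
  rewrite big_enum /=; apply: eq_bigr => x _.
  rewrite big_enum -sum1_card big_mkcond [RHS]big_mkcond /=.
  by apply: eq_bigr => y _; rewrite inE; case: (y \in K); case: (e x y).
elim: (enum K) => [|x s IHs]; first by rewrite big_nil.
rewrite big_cons big_cons e_irr add0n.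
under [X in (_ + X)%N]eq_bigr do rewrite big_cons e_sym.
by rewrite big_split /= addnA addnn oddD odd_double IHs.
Qed.

Lemma odd_degree_pair (K : {set T}) x :
    x \in K -> odd #|[set y in K | e x y]| ->
  exists2 y, y \in K & y != x /\ odd #|[set z in K | e y z]|.
Proof.
move=> Kx odd_x.
have [/existsP[y /and3P[Ky yx oy]]|noy] :=
  boolP [exists y, [&& y \in K, y != x & odd #|[set z in K | e y z]|]].
  by exists y.
have := odd_degree_sum K; rewrite (bigD1 x) //= oddD odd_x /=.
suff -> : odd (\sum_(i in K | i != x) #|[set y in K | e i y]|) = false by [].
rewrite (big_morph odd oddD (erefl _)) big1 // => y /andP[Ky yx].
by apply: contraNF noy => oy; apply/existsP; exists y; rewrite Ky yx.
Qed.

End Handshake.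

(** * Face systems on product graphs *)

Section ProductFaceSystem.
Import mathcomp.boot.fintype mathcomp.boot.finset.
Variables (R : realType) (G H : sgraph) (FF : {set {set cprod G H}}).
Hypothesis FFP : @face_system R (cprod G H) FF.

Notation X := (cprod G H).
Notation frame := ((G * G) * (H * H))%type.
Implicit Types (S : {set X}) (t : frame).

(** A mixed corner ((a, a'), (b, b')) has its apex at (a, b), and its two edges
    lead to (a', b) and (a, b'). *)
Definition corners : {set frame} :=
  [set t | gadj t.1.1 t.1.2 && gadj t.2.1 t.2.2].
Definition apex t : X := (t.1.1, t.2.1).
Definition Gend t : X := (t.1.2, t.2.1).
Definition Hend t : X := (t.1.1, t.2.2).

(** The face spanned by the two edges of [t]; the default value is never taken
    on [corners], by [two_faceP]. *)
Definition two_face t : {set X} :=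
  odflt set0 [pick S in FF |
    (apex t \in S) && (nbrs (apex t) :&: S == [set Gend t; Hend t])].

Lemma nbrsE (x y : X) :
  (y \in nbrs x)
  = ((x.1 == y.1) && gadj x.2 y.2) || ((x.2 == y.2) && gadj x.1 y.1).
Proof. by rewrite inE. Qed.

Lemma corner_ends t :
  t \in corners -> [set Gend t; Hend t] \subset nbrs (apex t).
Proof.
rewrite inE => /andP[e1 e2]; apply/subsetP => y; rewrite in_set2 nbrsE.
by case/orP => /eqP -> /=; rewrite eqxx ?e1 ?e2 ?orbT.
Qed.

Lemma two_faceP t : t \in corners ->
  [/\ two_face t \in FF, apex t \in two_face t
    & nbrs (apex t) :&: two_face t = [set Gend t; Hend t]].
Proof.
move=> Tt; rewrite /two_face; case: pickP => [S /and3P[FS ? /eqP ?] //|noS].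
have [S [FS aS nS]] := fs_span FFP (corner_ends Tt).
by have := noS S; rewrite FS aS nS eqxx.
Qed.

Lemma ends_neq t : t \in corners -> Gend t != Hend t.
Proof.
rewrite inE => /andP[e1 e2]; apply/eqP => -[E _].
by move: e1; rewrite E gadj_irr.
Qed.

Lemma two_face_regular t x : t \in corners -> x \in two_face t ->
  #|nbrs x :&: two_face t| = 2.
Proof.
move=> Tt xS; have [FS aS nS] := two_faceP Tt.
by rewrite (fs_regular FFP FS xS aS) nS cards2 ends_neq.
Qed.

Definition corner_of S t :=
  [&& t \in corners, apex t \in S, Gend t \in S & Hend t \in S].

(** A mixed corner [t'] inside a 2-face accounts for all edges of that 2-face at
    the apex of [t'], by regularity, so it spans the same 2-face. *)
Lemma two_face_corner t t' : t \in corners -> t' \in corners ->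
  (two_face t' == two_face t) = corner_of (two_face t) t'.
Proof.
move=> Tt Tt'; have [FS aS nS] := two_faceP Tt.
have [FS' aS' nS'] := two_faceP Tt'.
have [g'S' h'S'] : Gend t' \in two_face t' /\ Hend t' \in two_face t'.
  have : [set Gend t'; Hend t'] \subset two_face t' by rewrite -nS' subsetIr.
  by rewrite subUset !sub1set => /andP.
apply/eqP/idP => [<-|]; rewrite /corner_of Tt' /=.
  by rewrite aS' g'S' h'S'.
case/and3P => a'S g'S h'S.
have sub : nbrs (apex t') :&: two_face t' \subset nbrs (apex t') :&: two_face t.
  rewrite nS' subUset !sub1set !(in_setI _ (nbrs _)) g'S h'S !andbT.
  by have := corner_ends Tt'; rewrite subUset !sub1set.
have /eqP eqn : nbrs (apex t') :&: two_face t' == nbrs (apex t') :&: two_face t.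
  by rewrite eqEcard sub (two_face_regular Tt a'S) (two_face_regular Tt' aS').
apply/eqP; rewrite eqEsubset; apply/andP; split.
  by apply: (fs_subset FFP FS' FS aS' a'S); rewrite eqn subsetIr.
by apply: (fs_subset FFP FS FS' a'S aS'); rewrite -eqn subsetIr.
Qed.

Lemma nbrs_split S (x : X) :
  #|nbrs x :&: S| = (#|[set a in [set a | (a, x.2) \in S] | gadj x.1 a]|
                     + #|[set b in [set b | (x.1, b) \in S] | gadj x.2 b]|)%N.
Proof.
have injG : injective (fun a : G => (a, x.2) : X) by move=> a a' [].
have injH : injective (fun b : H => (x.1, b) : X) by move=> b b' [].
rewrite -(card_imset _ injG) -(card_imset _ injH) -cardsUI.
rewrite [X in (_ + #|pred_of_set X|)%N](_ : _ = set0) ?cards0 ?addn0.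
  apply: eq_card => -[a b]; rewrite !inE /= /cprod_adj /=.
  apply/andP/orP => [[/orP[|] /andP[/eqP E e] Sab]|[]].
  - by right; apply/imsetP; exists b; rewrite ?inE ?E ?Sab.
  - by left; apply/imsetP; exists a; rewrite ?inE ?E ?Sab.
  - case/imsetP => a'; rewrite !inE => /andP[Sa e] [-> ->].
    by rewrite eqxx e orbT.
  - by case/imsetP => b'; rewrite !inE => /andP[Sb e] [-> ->]; rewrite eqxx e.
apply/setP => -[a b]; rewrite !inE; apply/andP => -[].
case/imsetP => a'; rewrite !inE => /andP[? e] [-> ->].
by case/imsetP => b' _ [E _]; rewrite E gadj_irr in e.
Qed.

Lemma card_nbrs_cprod (a : G) (b : H) :
  #|nbrs ((a, b) : X)| = (#|nbrs a| + #|nbrs b|)%N.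
Proof.
rewrite -[nbrs ((a, b) : X)]setIT nbrs_split /=.
by congr (_ + _)%N; apply: eq_card => c; rewrite !inE.
Qed.

(** The two edges of [S] at a vertex split as 2 + 0, 1 + 1 or 0 + 2 between the
    two factors, so an odd degree in one factor means a mixed corner. *)
Lemma mixed_corner S (a : G) (b : H) : #|nbrs ((a, b) : X) :&: S| = 2 ->
  (a, b) \in S ->
  odd #|[set b' in [set b' | (a, b') \in S] | gadj b b']| \/
  odd #|[set a' in [set a' | (a', b) \in S] | gadj a a']| ->
  exists a' b', corner_of S ((a, a'), (b, b')).
Proof.
rewrite nbrs_split /= => c2 abS odd12.
have [/eqP/cards1P[a' Ea] /eqP/cards1P[b' Eb]] :
    #|[set a' in [set a' | (a', b) \in S] | gadj a a']| = 1%N /\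
    #|[set b' in [set b' | (a, b') \in S] | gadj b b']| = 1%N.
  by move: c2 odd12; move: #|_| #|_| => [|[|[|m]]] [|[|[|n]]] // _ [].
have := set11 a'; have := set11 b'.
rewrite -{1}Ea -{1}Eb !inE /= => /andP[? ?] /andP[? ?].
exists a', b'; rewrite /corner_of inE /=.
by apply/and4P; split=> //; apply/andP.
Qed.

Lemma corner_degrees S a a' b b' : corner_of S ((a, a'), (b, b')) ->
  #|nbrs ((a, b) : X) :&: S| = 2 ->
  #|[set a' in [set a' | (a', b) \in S] | gadj a a']| = 1%N /\
  #|[set b' in [set b' | (a, b') \in S] | gadj b b']| = 1%N.
Proof.
rewrite /corner_of inE => /and4P[/andP[/= e1 e2] abS aS bS].
rewrite nbrs_split /=.
have : (0 < #|[set a' in [set a' | (a', b) \in S] | gadj a a']|)%N.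
  by apply/card_gt0P; exists a'; rewrite !inE e1 andbT.
have : (0 < #|[set b' in [set b' | (a, b') \in S] | gadj b b']|)%N.
  by apply/card_gt0P; exists b'; rewrite !inE e2 andbT.
by move: #|_| #|_| => [|[|[|m]]] [|[|[|n]]].
Qed.

(** Within the row of [a] the set [S] has odd degree exactly at its mixed
    corners, so their number is even. *)
Lemma corner_row S a a' b b' :
  (forall x, x \in S -> #|nbrs x :&: S| = 2) ->
  corner_of S ((a, a'), (b, b')) ->
  exists b1 a2 b2, b1 != b /\ corner_of S ((a, a2), (b1, b2)).
Proof.
move=> reg cS; have abS : (a, b) \in S by case/and4P: cS.
have [_ oddb] := corner_degrees cS (reg _ abS).
have [||b1] := odd_degree_pair (@gadj_sym H) (@gadj_irr H)
  (K := [set b | (a, b) \in S]) (x := b).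
- by rewrite inE.
- by rewrite oddb.
rewrite inE => ab1S [b1b odd1].
have [|a2 [b2 c2]] := @mixed_corner S a b1 (reg _ ab1S) ab1S; first by left.
by exists b1, a2, b2.
Qed.

Lemma corner_column S a a' b b' :
  (forall x, x \in S -> #|nbrs x :&: S| = 2) ->
  corner_of S ((a, a'), (b, b')) ->
  exists a1 a2 b2, a1 != a /\ corner_of S ((a1, a2), (b, b2)).
Proof.
move=> reg cS; have abS : (a, b) \in S by case/and4P: cS.
have [odda _] := corner_degrees cS (reg _ abS).
have [||a1] := odd_degree_pair (@gadj_sym G) (@gadj_irr G)
  (K := [set a | (a, b) \in S]) (x := a).
- by rewrite inE.
- by rewrite odda.
rewrite inE => ab1S [b1b odd1].
have [|a2 [b2 c2]] := @mixed_corner S a1 b (reg _ ab1S) ab1S; first by right.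
by exists a1, a2, b2.
Qed.

Lemma four_corners S t :
  (forall x, x \in S -> #|nbrs x :&: S| = 2) -> corner_of S t ->
  (4 <= #|[set t | corner_of S t]|)%N.
Proof.
move: t => -[[a a'] [b b']] reg c0.
have [b1 [a2 [b2 [b1b c1]]]] := corner_row reg c0.
have [a3 [a4 [b4 [a3a c2]]]] := corner_column reg c0.
have [a5 [a6 [b6 [a5a c3]]]] := corner_column reg c1.
set s := [:: ((a, a'), (b, b')); ((a, a2), (b1, b2));
             ((a3, a4), (b, b4)); ((a5, a6), (b1, b6))].
have us : uniq s.
  rewrite /= !inE !xpair_eqE !negb_or !(eq_sym a) (negPf a3a) (negPf a5a).
  by rewrite (eq_sym b) (negPf b1b) /= !andbF.
have -> : 4%N = size s by [].
rewrite -(card_uniqP us); apply/subset_leq_card/subsetP => t.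
by rewrite !inE => /or4P[]/eqP ->.
Qed.

Definition Gflip t : frame := ((t.1.2, t.1.1), t.2).
Definition Hflip t : frame := (t.1, (t.2.2, t.2.1)).

Definition top_corners (phi : X -> R) : {set frame} :=
  [set t in corners |
    (phi (Gend t) <= phi (apex t)) && (phi (Hend t) <= phi (apex t))].

(** Flipping an edge of a mixed corner moves the apex along it; the four corners
    so obtained from a given one run around a square, and the highest of the
    four apexes belongs to a top corner. *)
Lemma card_corners phi : (#|corners| <= 4 * #|top_corners phi|)%N.
Proof.
pose A := top_corners phi.
have GK : involutive Gflip by case=> [[]].
have HK : involutive Hflip by case=> [? []].
suff sub : corners \subset
    (A :|: Gflip @: A) :|: (Hflip @: A :|: Gflip @: (Hflip @: A)).
  apply: leq_trans (subset_leq_card sub) _.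
  have le_im f (B : {set frame}) : (#|f @: B : {set frame}| <= #|B|)%N.
    exact: leq_imset_card.
  apply: leq_trans (leq_of_leqif (leq_card_setU _ _)) _.
  rewrite (_ : 4 = 2 + 2)%N // mulnDl !mul2n -!addnn; apply: leq_add.
    apply: leq_trans (leq_of_leqif (leq_card_setU _ _)) _.
    by rewrite leq_add2l le_im.
  apply: leq_trans (leq_of_leqif (leq_card_setU _ _)) _.
  by apply: leq_add; rewrite ?(leq_trans (le_im _ _)) ?le_im.
have memG t (B : {set frame}) : (t \in Gflip @: B) = (Gflip t \in B).
  by rewrite -{1}(GK t) mem_imset //; apply: inv_inj.
have memH t (B : {set frame}) : (t \in Hflip @: B) = (Hflip t \in B).
  by rewrite -{1}(HK t) mem_imset //; apply: inv_inj.
apply/subsetP => -[[a a'] [b b']].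
rewrite [in X in X -> _]inE => /andP[/= e1 e2].
rewrite !in_setU !memG !memH !inE /= /Gend /Hend /apex /=.
rewrite (gadj_sym a') (gadj_sym b') e1 e2 /=.
move: (phi (a, b)) (phi (a', b)) (phi (a, b')) (phi (a', b')) => p q r s.
have [/orP[pq|qp] /orP[pr|rp]] := (le_total p q, le_total p r);
  have [/orP[qs|sq] /orP[rs|sr]] := (le_total q s, le_total r s);
  rewrite ?pq ?qp ?pr ?rp ?qs ?sq ?rs ?sr ?orbT //=.
- by rewrite (le_trans (le_trans pq qs) sr) !orbT.
- by rewrite (le_trans (le_trans pr rs) sq) !orbT.
Qed.

(** The apex of a top corner is the maximum of the 2-face that the corner spans,
    and the 2-face with its apex determines the two edges. *)
Lemma two_face_inj_top phi : injective phi -> unimodal FF phi ->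
  {in top_corners phi &, injective two_face}.
Proof.
move=> phi_inj sink t t'.
rewrite !inE => /andP[Tt /andP[gt ht]] /andP[Tt' /andP[gt' ht']] E.
have {}Tt : t \in corners by rewrite inE.
have {}Tt' : t' \in corners by rewrite inE.
have [FS aS nS] := two_faceP Tt.
have [FS' aS' nS'] := two_faceP Tt'.
have top u : u \in [set Gend t; Hend t] -> phi u <= phi (apex t).
  by rewrite in_set2 => /orP[]/eqP ->.
have top' u : u \in [set Gend t'; Hend t'] -> phi u <= phi (apex t').
  by rewrite in_set2 => /orP[]/eqP ->.
have Ea : apex t = apex t'.
  apply/phi_inj/le_anti/andP; split.
    apply: (sink _ _ FS') => //; last by rewrite -E.
    by move=> u; rewrite nS'; apply: top'.
  apply: (sink _ _ FS) => //; last by rewrite E.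
  by move=> u; rewrite nS; apply: top.
have : [set Gend t; Hend t] = [set Gend t'; Hend t'] by rewrite -nS -nS' E Ea.
move: Ea Tt Tt'; clear; case: t t' => [[a a'] [b b']] [[a1 a1'] [b1 b1']].
case=> <- <-; rewrite !inE /= => /andP[e1 e2] /andP[e3 e4] E.
have := set21 (Gend ((a, a'), (b, b'))) (Hend ((a, a'), (b, b'))).
rewrite E in_set2 => /orP[/eqP[->]|/eqP[E1]]; last by rewrite E1 gadj_irr in e1.
have := set22 (Gend ((a, a'), (b, b'))) (Hend ((a, a'), (b, b'))).
rewrite E in_set2 => /orP[/eqP[E1]|/eqP[->] //].
by rewrite E1 gadj_irr in e3.
Qed.

(** Writing MM for the set of mixed 2-faces, [four_corners], [card_corners] and
    [two_face_inj_top] give 4 |MM| <= |corners| <= 4 |top corners| <= 4 |MM|, so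
    all are equalities.  The second claim uses [phi] peaking at [x]: the top of
    the 2-face, namely [x], is then the apex of a top corner. *)
Lemma two_face_corners t : t \in corners ->
  #|[set t' | corner_of (two_face t) t']| = 4%N /\
  (forall x, x \in two_face t ->
    exists2 t', corner_of (two_face t) t' & x = apex t').
Proof.
move=> Tt; pose fib S := [set t' in corners | two_face t' == S].
have fibE t0 : t0 \in corners ->
    fib (two_face t0) = [set t' | corner_of (two_face t0) t'].
  move=> Tt0; apply/setP => t'; rewrite !inE -/(t' \in corners).
  have [Tt'|Tt'] := boolP (t' \in corners).
    by rewrite two_face_corner //; move: Tt'; rewrite inE => ->.
  by rewrite /corner_of (negPf Tt'); move: Tt'; rewrite inE => /negPf ->.
have fib4 t0 : t0 \in corners -> (4 <= #|fib (two_face t0)|)%N.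
  move=> Tt0; rewrite fibE //; apply: (@four_corners _ t0).
    by move=> x; apply: two_face_regular.
  by rewrite -two_face_corner.
pose MM := two_face @: corners.
have cardT : (#|corners| = \sum_(S in MM) #|fib S|)%N.
  rewrite -sum1_card (partition_big_imset two_face) /=; apply: eq_bigr => S _.
  by rewrite -sum1_card; apply: eq_bigl => t'; rewrite !inE.
have le4 : (4 * #|MM| <= #|corners|)%N.
  rewrite cardT mulnC -sum_nat_const leq_sum // => _ /imsetP[t0 Tt0 ->].
  exact: fib4.
have topMM (phi : X -> R) : injective phi -> unimodal FF phi ->
    two_face @: top_corners phi = MM /\ #|corners| = (4 * #|MM|)%N.
  move=> phi_inj sink.
  have cardtop := card_in_imset (two_face_inj_top phi_inj sink).
  have subMM : two_face @: top_corners phi \subset MM.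
    by apply: imsetS; apply/subsetP => t'; rewrite inE => /andP[].
  have := card_corners phi; rewrite -cardtop => le_top.
  have le_im := subset_leq_card subMM.
  have le_MM : (#|MM| <= #|two_face @: top_corners phi|)%N.
    by rewrite -(leq_pmul2l (isT : 0 < 4)%N) (leq_trans le4).
  split; first by apply/eqP; rewrite eqEcard subMM.
  apply/eqP; rewrite eqn_leq le4 andbT (leq_trans le_top) //.
  by rewrite leq_pmul2l.
split.
  have [phi [phi_inj _ sink]] := fs_sink FFP (apex t).
  have [_ E4] := topMM phi phi_inj sink.
  rewrite -fibE //; apply/eqP; rewrite eqn_leq fib4 // andbT leqNgt.
  apply/negP => lt4; have : (4 * #|MM| < #|corners|)%N.
    rewrite cardT mulnC -sum_nat_const (bigD1 (two_face t)) ?imset_f //=.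
    rewrite [X in (_ < X)%N](bigD1 (two_face t)) ?imset_f //= -addSn leq_add //.
    by apply: leq_sum => _ /andP[/imsetP[t0 Tt0 ->] _]; apply: fib4.
  by rewrite E4 ltnn.
move=> x xS; have [phi [phi_inj phi_max sink]] := fs_sink FFP x.
have [EMM _] := topMM phi phi_inj sink.
have : two_face t \in MM by apply: imset_f.
rewrite -EMM => /imsetP[t0]; rewrite inE => /andP[Tt0 /andP[g0 h0]] E.
exists t0; first by rewrite -two_face_corner // E.
have [FS aS nS] := two_faceP Tt0.
apply/phi_inj/le_anti; rewrite phi_max andbT.
apply: (sink _ _ FS) => //; last by rewrite -E.
by move=> u; rewrite nS in_set2 => /orP[]/eqP ->.
Qed.

Lemma corner_apex_inj t t1 t2 : t \in corners ->
  corner_of (two_face t) t1 -> corner_of (two_face t) t2 ->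
  apex t1 = apex t2 -> t1 = t2.
Proof.
move: t1 t2 => [[a a1] [b b1]] [[a' a2] [b' b2]] Tt c1 c2 [Ea Eb].
rewrite -{}Ea -{}Eb in c2 *; have abS : (a, b) \in two_face t by case/and4P: c1.
have [/eqP/cards1P[a3 Ea] /eqP/cards1P[b3 Eb]] :=
  corner_degrees c1 (two_face_regular Tt abS).
case/and4P: c1; rewrite inE /= => /andP[e1 e2] _ G1 H1.
case/and4P: c2; rewrite inE /= => /andP[e3 e4] _ G2 H2.
have in1 c : gadj a c -> (c, b) \in two_face t -> c = a3.
  by move=> e ?; apply/set1P; rewrite -Ea !inE e andbT.
have in2 c : gadj b c -> (a, c) \in two_face t -> c = b3.
  by move=> e ?; apply/set1P; rewrite -Eb !inE e andbT.
by rewrite (in1 _ e1 G1) (in1 _ e3 G2) (in2 _ e2 H1) (in2 _ e4 H2).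
Qed.

(** All vertices of the 2-face are apexes of mixed corners and there are at most
    four.  A further vertex in the row of (a', b) and one in the column of
    (a, b') must therefore coincide, at (a', b'). *)
Lemma opposite_corner a a' b b' : gadj a a' -> gadj b b' ->
  (a', b') \in two_face ((a, a'), (b, b')).
Proof.
move=> eG eH; set t := ((a, a'), (b, b')).
have Tt : t \in corners by rewrite inE eG.
have [c4 mixed] := two_face_corners Tt; set S := two_face t in c4 mixed *.
have reg x : x \in S -> #|nbrs x :&: S| = 2 by apply: two_face_regular.
have card4 : (#|S| <= 4)%N.
  have <- : #|apex @: [set t' | corner_of S t']| = 4%N.
    rewrite card_in_imset // => t1 t2; rewrite !inE; exact: corner_apex_inj.
  apply: subset_leq_card; apply/subsetP => x /mixed[t' ct' ->].
  by apply: imset_f; rewrite inE.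
have : corner_of S t by rewrite -two_face_corner.
case/and4P => _ aS gS hS.
have [[[a1 a2] [b1 b2]] c1 [E1 E2]] := mixed _ gS; rewrite /= in E1 E2.
rewrite -{}E1 -{}E2 in c1; have [b3 [a4 [b4 [b3b c3]]]] := corner_row reg c1.
have [[[a5 a6] [b5 b6]] c5 [E1 E2]] := mixed _ hS; rewrite /= in E1 E2.
rewrite -{}E1 -{}E2 in c5; have [a7 [a8 [b8 [a7a c7]]]] := corner_column reg c5.
have gS' : (a', b3) \in S by case/and4P: c3.
have hS' : (a7, b') \in S by case/and4P: c7.
have aa' : a != a' by apply: contraTneq eG => ->; rewrite gadj_irr.
have bb' : b != b' by apply: contraTneq eH => ->; rewrite gadj_irr.
have [/eqP[_ <-] //|ne] := boolP ((a', b3) == (a7, b') :> X).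
set s := [:: (a, b) : X; (a', b); (a, b'); (a', b3); (a7, b')].
suff us : uniq s.
  have : (size s <= #|S|)%N.
    rewrite -(card_uniqP us); apply/subset_leq_card/subsetP => x.
    by rewrite !inE => /or4P[|||/orP[]]/eqP ->.
  by rewrite leqNgt ltnS card4.
move/negPf: aa' => aa'; move/negPf: bb' => bb'; move/negPf: ne => ne.
move/negPf: b3b => b3b; move/negPf: a7a => a7a.
rewrite /= !inE ne !xpair_eqE ?(eq_sym a' a) ?(eq_sym b' b) aa' bb'.
by rewrite ?(eq_sym b b3) b3b ?(eq_sym a a7) a7a ?andbF.
Qed.

(** Let [F] be spanned by the G-edges at (a0, b0).  If it has an H-edge at
    (a', b0), reached by a G-edge from (a, b0), then it contains the square on
    these two edges, hence an H-edge at (a, b0).  So having exactly the G-edges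
    propagates along G; connectedness of the graph and of [F] does the rest. *)
Lemma fiber_face (b0 : H) : [set x : X | x.2 == b0] \in FF.
Proof.
have [a0 _] := card_gt0P (gvertex_gt0 G).
pose Gn (a : G) : {set X} := [set x | (x.2 == b0) && gadj a x.1].
have Gn_sub a : Gn a \subset nbrs ((a, b0) : X).
  apply/subsetP => x; rewrite inE nbrsE /= eq_sym => /andP[-> ->].
  by rewrite orbT.
have cardGn a : #|Gn a| = #|nbrs a|.
  have inj : injective (fun a : G => (a, b0) : X) by move=> ? ? [].
  rewrite -(card_imset _ inj); apply: eq_card => -[c b]; rewrite inE /=.
  apply/andP/imsetP => [[/eqP -> e]|[c' + [-> ->]]].
    by exists c; rewrite ?inE.
  by rewrite inE => ->; rewrite eqxx.
have [F [FF_F aF nF]] := fs_span FFP (Gn_sub a0).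
have regG (a a' : G) : #|nbrs a| = #|nbrs a'|.
  have := fs_regular FFP (fs_whole FFP) (in_setT ((a, b0) : X))
                     (in_setT ((a', b0) : X)).
  by rewrite !setIT !card_nbrs_cprod => /addIn.
pose C := [set a | ((a, b0) \in F) && (nbrs ((a, b0) : X) :&: F == Gn a)].
have C0 : a0 \in C by rewrite inE aF nF eqxx.
have closedC a a' : a \in C -> gadj a a' -> a' \in C.
  rewrite !inE => /andP[aF' /eqP na] e.
  have a'F : (a', b0) \in F.
    have : (a', b0) \in nbrs ((a, b0) : X) :&: F by rewrite na inE eqxx.
    by rewrite inE => /andP[].
  rewrite a'F eqEcard (fs_regular FFP FF_F a'F aF') na !cardGn (regG a' a).
  rewrite leqnn andbT.
  apply/subsetP => -[c b]; rewrite in_setI nbrsE /= => /andP[adj bF].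
  rewrite inE /=; case/orP: adj => /andP[/eqP E e'];
    last by rewrite eq_sym E eqxx.
  (* an H-edge of F at (a', b0) would give one at (a, b0) *)
  exfalso; move: bF; rewrite -{c}E => bF.
  have e1 : gadj a' a by rewrite gadj_sym.
  have Tt : ((a', a), (b0, b)) \in corners by rewrite inE e1.
  have [FS aS nS] := two_faceP Tt.
  have sub : two_face ((a', a), (b0, b)) \subset F.
    apply: (fs_subset FFP FS FF_F aS a'F).
    by rewrite nS subUset !sub1set; apply/andP.
  have abF : (a, b) \in F by apply: (subsetP sub); apply: opposite_corner.
  have : (a, b) \in nbrs ((a, b0) : X) :&: F.
    by rewrite in_setI abF nbrsE /= eqxx e'.
  rewrite na inE /= => /andP[/eqP E _].
  by rewrite E gadj_irr in e'.
have CT a : a \in C.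
  have : setT \subset [set x : X | x.1 \in C].
    apply: (face_connected FFP (fs_whole FFP)); first exact: subsetT.
      by exists (a0, b0); rewrite inE.
    move=> y u; rewrite inE => yC; rewrite in_setI nbrsE => /andP[adj _].
    rewrite inE; case/orP: adj => /andP[/eqP E e]; first by rewrite -E.
    exact: closedC e.
  by move/subsetP/(_ ((a, b0) : X) (in_setT _)); rewrite inE.
suff -> : [set x : X | x.2 == b0] = F by [].
have sub : [set x : X | x.2 == b0] \subset F.
  apply/subsetP => -[a b]; rewrite inE /= => /eqP ->.
  by have := CT a; rewrite inE => /andP[].
apply/eqP; rewrite eqEsubset sub /=; apply: (face_connected FFP FF_F sub).
  by exists (a0, b0); rewrite inE /=.
move=> [a b] u; rewrite inE /= => /eqP ->.
by have := CT a; rewrite inE => /andP[_ /eqP ->]; rewrite !inE => /andP[].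
Qed.

End ProductFaceSystem.

Local Open Scope classical_set_scope.

(** * Linear functionals *)

Section Functionals.
Variables (R : realType) (N : nat).
Implicit Types (x y g : 'rV[R]_N) (a b : 'cV[R]_N).

Definition dot a x : R := (x *m a) 0 0.

Lemma dotDr a x y : dot a (x + y) = dot a x + dot a y.
Proof. by rewrite /dot mulmxDl mxE. Qed.

Lemma dotZr a k x : dot a (k *: x) = k * dot a x.
Proof. by rewrite /dot -scalemxAl mxE. Qed.

Lemma dotNr a x : dot a (- x) = - dot a x.
Proof. by rewrite /dot mulNmx mxE. Qed.

Lemma dotBr a x y : dot a (x - y) = dot a x - dot a y.
Proof. by rewrite dotDr dotNr. Qed.

Lemma dot0r a : dot a 0 = 0.
Proof. by rewrite /dot mul0mx mxE. Qed.

Lemma dot_sumr a n (p : 'I_n -> 'rV[R]_N) :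
  dot a (\sum_i p i) = \sum_i dot a (p i).
Proof. by rewrite /dot mulmx_suml summxE. Qed.

Lemma dotDl a b x : dot (a + b) x = dot a x + dot b x.
Proof. by rewrite /dot mulmxDr mxE. Qed.

Lemma dotZl k a x : dot (k *: a) x = k * dot a x.
Proof. by rewrite /dot -scalemxAr mxE. Qed.

Lemma dotNl a x : dot (- a) x = - dot a x.
Proof. by rewrite /dot mulmxN mxE. Qed.

Lemma dot0l x : dot 0 x = 0.
Proof. by rewrite /dot mulmx0 mxE. Qed.

Lemma dot_trmx_gt0 x : x != 0 -> 0 < dot x^T x.
Proof.
case/rV0Pn => j xj; rewrite /dot mxE (bigD1 j) //= mxE -expr2.
rewrite ltr_pwDl ?exprn_even_gt0 // sumr_ge0 // => i _.
by rewrite mxE -expr2 sqr_ge0.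
Qed.

(** The functional is a combination of the coordinate functions. *)
Lemma free_interpolate (E : seq 'rV[R]_N) (c : 'rV[R]_N -> R) :
  free E -> exists a, forall e, e \in E -> dot a e = c e.
Proof.
move=> freeE; pose X := in_tuple E.
pose a := \col_j \sum_(i < size E) c E`_i * coord X i (delta_mx 0 j).
exists a => e eE.
have -> : dot a e = \sum_(i < size E) c E`_i * coord X i e.
  rewrite /dot mxE {2}[e]row_sum_delta.
  under eq_bigr do rewrite mxE mulr_sumr.
  rewrite exchange_big /=; apply: eq_bigr => i _.
  rewrite linear_sum /= mulr_sumr; apply: eq_bigr => j _.
  by rewrite linearZ /= mulrCA.
have ltE : (index e E < size E)%N by rewrite index_mem.
rewrite (bigD1 (Ordinal ltE)) //= big1 ?addr0.
  have := @coord_free _ _ _ X (Ordinal ltE) (Ordinal ltE) freeE.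
  by rewrite /= nth_index // => ->; rewrite eqxx mulr1.
move=> i ne; have := @coord_free _ _ _ X (Ordinal ltE) i freeE.
by rewrite /= nth_index // => ->; rewrite eq_sym (negPf ne) mulr0.
Qed.

End Functionals.

(** * Cones and Farkas' lemma *)

Section Cones.
Variables (R : realType) (N : nat).
Implicit Types (x y g v : 'rV[R]_N) (a b : 'cV[R]_N) (B : set 'rV[R]_N).

Inductive cone B : 'rV[R]_N -> Prop :=
| cone0 : cone B 0
| cone_step t g x : 0 <= t -> B g -> cone B x -> cone B (t *: g + x).

Lemma cone_gen B g : B g -> cone B g.
Proof.
move=> Bg; rewrite -[g]addr0 -[g in g + _]scale1r.
by apply: cone_step => //; apply: cone0.
Qed.

Lemma coneD B x y : cone B x -> cone B y -> cone B (x + y).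
Proof.
move=> cx cy; elim: cx => [|t g z t0 Bg _ IH]; first by rewrite add0r.
by rewrite -addrA; apply: cone_step.
Qed.

Lemma coneZ B t x : 0 <= t -> cone B x -> cone B (t *: x).
Proof.
move=> t0; elim=> [|s g z s0 Bg _ IH]; first by rewrite scaler0; apply: cone0.
by rewrite scalerDr scalerA; apply: cone_step => //; apply: mulr_ge0.
Qed.

Lemma cone_cone B B' x : B `<=` cone B' -> cone B x -> cone B' x.
Proof.
move=> sB; elim=> [|t g z t0 /sB Bg _ IH]; first exact: cone0.
by apply: coneD => //; apply: coneZ.
Qed.

Lemma cone_sub B B' x : B `<=` B' -> cone B x -> cone B' x.
Proof. by move=> sB; apply: cone_cone => g /sB; apply: cone_gen. Qed.

Lemma cone_sum B n (w : 'I_n -> R) (p : 'I_n -> 'rV[R]_N) :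
  (forall i, 0 <= w i) -> (forall i, cone B (p i)) ->
  cone B (\sum_i w i *: p i).
Proof.
move=> w0 pB; apply: (big_ind (cone B)); [exact: cone0|exact: coneD|].
by move=> i _; apply: coneZ.
Qed.

Lemma cone_dot_le0 B a x :
  (forall g, B g -> dot a g <= 0) -> cone B x -> dot a x <= 0.
Proof.
move=> aB; elim=> [|t g z t0 Bg _ IH]; first by rewrite dot0r.
by rewrite dotDr dotZr; have := mulr_ge0_le0 t0 (aB g Bg); lra.
Qed.

Lemma cone_dot_eq0 B a x :
  (forall g, B g -> dot a g <= 0) -> cone B x -> dot a x = 0 ->
  cone (B `&` [set g | dot a g = 0]) x.
Proof.
move=> aB; elim=> [|t g z t0 Bg cz IH]; first by move=> _; apply: cone0.
rewrite dotDr dotZr => e.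
have ag := aB g Bg; have az := cone_dot_le0 aB cz.
have tg := mulr_ge0_le0 t0 ag.
have cz' : cone (B `&` [set g | dot a g = 0]) z by apply: IH; lra.
have /eqP : t * dot a g = 0 by lra.
rewrite mulf_eq0 => /orP[/eqP ->|/eqP ag0]; first by rewrite scale0r add0r.
by apply: cone_step.
Qed.

Lemma cone_in_vspace B (U : {vspace 'rV[R]_N}) x :
  (forall g, B g -> g \in U) -> cone B x -> x \in U.
Proof.
move=> BU; elim=> [|t g z t0 Bg _ IH]; first exact: mem0v.
by apply: memvD => //; apply/memvZ/BU.
Qed.

(** Induction on the number of generators.  If the functional [a] found for all
    generators but [w] is positive at [w], project everything along [w] onto the
    hyperplane where [a] vanishes: membership of the projected [x] in the
    projected cone lifts back, and a separating functional pulls back. *)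
Lemma farkas (s : seq 'rV[R]_N) x :
  cone [set` s] x \/
  exists a, (forall g, g \in s -> dot a g <= 0) /\ 0 < dot a x.
Proof.
elim: {s}(size s) {-2}s (erefl (size s)) x => [|n IH] [|w s] //= sz x.
  have [->|x0] := eqVneq x 0; first by left; apply: cone0.
  by right; exists x^T; split=> //; apply: dot_trmx_gt0.
case: sz => sz; have [cx|[a [as_ ax]]] := IH s sz x.
  by left; apply: cone_sub cx => g /= gs; rewrite inE gs orbT.
have [aw|aw] := leP (dot a w) 0.
  by right; exists a; split=> // g; rewrite inE => /orP[/eqP ->//|]; apply: as_.
pose pr y := y - (dot a y / dot a w) *: w.
have [|cx|[b [bs bx]]] := IH (map pr s) _ (pr x); first by rewrite size_map.
  left; have -> : x = (dot a x / dot a w) *: w + pr x by rewrite addrC subrK.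
  apply: cone_step; first by rewrite divr_ge0 ?ltW.
    by rewrite /= inE eqxx.
  apply: cone_cone cx => _ /= /mapP[g gs ->].
  rewrite /pr addrC -scaleNr; apply: cone_step.
  - by rewrite -mulNr divr_ge0 ?(ltW aw) // oppr_ge0 as_.
  - by rewrite /= inE eqxx.
  - by apply: cone_gen; rewrite /= inE gs orbT.
right; exists (b - (dot b w / dot a w) *: a).
have dE y : dot (b - (dot b w / dot a w) *: a) y = dot b (pr y).
  by rewrite dotDl dotNl dotZl dotBr dotZr; ring.
rewrite dE; split=> // g; rewrite inE dE => /orP[/eqP ->|gs].
  by rewrite /pr divff ?gt_eqF // scale1r subrr dot0r.
by apply: bs; apply: map_f.
Qed.

(** Since [a] is negative on all generators, a nontrivial nonnegative
    combination of [s] on the line of [g] would be a positive multiple of [g].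
    So for [h] in [s], [- h] is not in the cone generated by [s], [g] and [- g];
    by Farkas' lemma there is a functional that vanishes at [g], is nonpositive
    on [s] and negative at [h].  The sum of these functionals over [h] is
    negative on all of [s]. *)
Lemma extreme_ray_functional (s : seq 'rV[R]_N) g a :
    (forall h, h \in s -> dot a h < 0) -> dot a g < 0 -> ~ cone [set` s] g ->
  exists b, dot b g = 0 /\ forall h, h \in s -> dot b h < 0.
Proof.
move=> as_ ag ncg.
have sep1 h : h \in s -> exists b, [/\ dot b g = 0,
    forall h', h' \in s -> dot b h' <= 0 & dot b h < 0].
  move=> hs; have [c|[b [bs bh]]] := farkas [:: g, - g & s] (- h).
    exfalso; apply: ncg.
    have [t [x [cx E]]] : exists t x, cone [set` s] x /\ - h = t *: g + x.
      elim: c => [|u e z u0 es _ [t [x [cx ->]]]].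
        by exists 0, 0; split; [apply: cone0 | rewrite scale0r addr0].
      move: es; rewrite /= !inE => /or3P[/eqP ->|/eqP ->|es].
      - by exists (u + t), x; split=> //; rewrite scalerDl addrA.
      - exists (t - u), x; split=> //.
        by rewrite scalerBl scalerN addrA (addrC (- _)).
      - by exists t, (u *: e + x); split; [apply: cone_step | rewrite addrCA].
    have ax : dot a x <= 0 by apply: cone_dot_le0 cx => e /as_ /ltW.
    have t0 : t < 0.
      rewrite ltNge; apply/negP => t0.
      have := congr1 (dot a) E; rewrite dotNr dotDr dotZr.
      by have := as_ h hs; have := mulr_ge0_le0 t0 (ltW ag); lra.
    have -> : g = (- t)^-1 *: (h + x).
      have -> : h + x = - t *: g by rewrite -[h]opprK E opprD addrNK scaleNr.
      by rewrite scalerA mulVf ?scale1r // oppr_eq0 lt_eqF.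
    apply: coneZ; first by rewrite invr_ge0 oppr_ge0 ltW.
    by apply: coneD => //; apply: cone_gen.
  rewrite dotNr in bh.
  have bg : dot b g <= 0 by apply: bs; rewrite inE eqxx.
  have bNg : dot b (- g) <= 0 by apply: bs; rewrite !inE eqxx orbT.
  rewrite dotNr in bNg.
  exists b; split; [|by move=> h' hs'; apply: bs; rewrite !inE hs' !orbT|lra].
  by lra.
have sep (s' : seq 'rV[R]_N) : {subset s' <= s} -> exists b, [/\ dot b g = 0,
    forall h, h \in s -> dot b h <= 0 & forall h, h \in s' -> dot b h < 0].
  elim: s' => [|h s' IH] ss'.
    by exists 0; split=> [|h _|//]; rewrite dot0l.
  have [e es|b [bg bs bs']] := IH _; first by apply: ss'; rewrite inE es orbT.
  have [|c [cg cs ch]] := sep1 h; first by rewrite ss' ?inE ?eqxx.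
  exists (b + c); split=> [|e es|e]; rewrite ?dotDl; first by lra.
    by have := bs e es; have := cs e es; lra.
  rewrite inE => /orP[/eqP ->|es]; rewrite ?dotDl.
    by have := bs h (ss' h (mem_head _ _)); lra.
  by have := bs' e es; have := cs e (ss' e (mem_behead (s := h :: s') es)); lra.
have [//|b [bg _ bs]] := sep s; by exists b.
Qed.

(** Discard generators that lie in the cone of the others; the remaining ones
    span the extreme rays of a pointed cone, and each is exposed by some [b]. *)
Lemma irredundant_generators (s : seq 'rV[R]_N) a :
    (forall h, h \in s -> dot a h < 0) ->
  exists s' : seq 'rV[R]_N, [/\ {subset s' <= s}, [set` s] `<=` cone [set` s'] &
    forall g, g \in s' -> exists b, dot b g = 0 /\
      forall h, h \in s' -> h != g -> dot b h < 0].
Proof.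
elim: {s}(size s) {-2}s (erefl (size s)) => [|n IH] s sz as_.
  by exists s; split=> // [g|g]; [apply: cone_gen | rewrite (size0nil sz)].
have [[g [gs cg]]|noredun] :=
  pselect (exists g, g \in s /\ cone [set` rem g s] g).
  have [||s' [ss' cs' bs']] := IH (rem g s).
  - by rewrite size_rem // sz.
  - by move=> h /mem_rem; apply: as_.
  exists s'; split=> // [h /ss' /mem_rem //|h hs].
  apply: (cone_cone cs'); have [->//|hg] := eqVneq h g.
  apply: cone_gen => /=; have : h \in s by [].
  rewrite (perm_mem (perm_to_rem gs)) inE.
  by rewrite (negPf hg).
exists s; split=> // [g|g gs]; first exact: cone_gen.
have [|||b [bg bs]] := @extreme_ray_functional (rem g s) g a.
- by move=> h /mem_rem; apply: as_.
- exact: as_.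
- by move=> cg; apply: noredun; exists g.
exists b; split=> // h hs hg; apply: bs.
by have := perm_to_rem gs => /perm_mem/(_ h); rewrite hs inE (negPf hg).
Qed.

End Cones.

(** * Hulls, faces and dimension *)

Section Hulls.
Variables (R : realType) (N : nat).
Implicit Types (x y u v w : 'rV[R]_N) (a b : 'cV[R]_N) (A P F : set 'rV[R]_N).

Lemma sum_enum_val (V : nmodType) (I : finType) (F : I -> V) :
  \sum_i F i = \sum_(i < #|I|) F (enum_val i).
Proof.
by rewrite (reindex (@enum_val I predT)) //; apply/onW_bij/enum_val_bij.
Qed.

Lemma convex_hull_fin A (I : finType) (w : I -> R) (p : I -> 'rV[R]_N) :
  (forall i, A (p i)) -> (forall i, 0 <= w i) -> \sum_i w i = 1 ->
  convex_hull A (\sum_i w i *: p i).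
Proof.
move=> pA w0 w1; exists #|I|, (w \o enum_val), (p \o enum_val).
split=> [i|i||] /=.
- exact: pA.
- exact: w0.
- by rewrite -w1 (sum_enum_val w).
- by rewrite (sum_enum_val (fun i => w i *: p i)).
Qed.

Lemma affine_hull_fin A (I : finType) (w : I -> R) (p : I -> 'rV[R]_N) :
  (forall i, A (p i)) -> \sum_i w i = 1 -> affine_hull A (\sum_i w i *: p i).
Proof.
move=> pA w1; exists #|I|, (w \o enum_val), (p \o enum_val); split=> [i||] /=.
- exact: pA.
- by rewrite -w1 (sum_enum_val w).
- by rewrite (sum_enum_val (fun i => w i *: p i)).
Qed.

Lemma sub_convex_hull A : A `<=` convex_hull A.
Proof.
move=> x Ax; have := @convex_hull_fin A unit (fun=> 1) (fun=> x).
by rewrite !big_const !card_unit /= scale1r !addr0; apply.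
Qed.

Lemma sub_affine_hull A : A `<=` affine_hull A.
Proof.
move=> x Ax; have := @affine_hull_fin A unit (fun=> 1) (fun=> x).
by rewrite !big_const !card_unit /= scale1r !addr0; apply.
Qed.

Lemma convex_hull_le A a c : (forall x, A x -> dot a x <= c) ->
  forall x, convex_hull A x -> dot a x <= c.
Proof.
move=> Ac _ [n [w [p [pA w0 w1 ->]]]].
rewrite dot_sumr -[c]mul1r -w1 mulr_suml ler_sum // => i _.
by rewrite dotZr ler_wpM2l ?Ac.
Qed.

Lemma convex_hull_convex A x y t : convex_hull A x -> convex_hull A y ->
  0 <= t <= 1 -> convex_hull A (x + t *: (y - x)).
Proof.
move=> [n [w [p [pA w0 w1 ->]]]] [m [w' [p' [pA' w0' w1' ->]]]] /andP[t0 t1].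
have := @convex_hull_fin A ('I_n + 'I_m)%type
  (fun i => match i with inl i => (1 - t) * w i | inr j => t * w' j end)
  (fun i => match i with inl i => p i | inr j => p' j end).
rewrite !big_sumType /= -!mulr_sumr w1 w1' !mulr1 subrK.
rewrite (_ : _ + _ = \sum_i w i *: p i
                     + t *: (\sum_i w' i *: p' i - \sum_i w i *: p i)).
  by apply=> // -[i|i] //; rewrite mulr_ge0 // subr_ge0.
under eq_bigr do rewrite -scalerA.
under [X in _ + X]eq_bigr do rewrite -scalerA.
by rewrite -!scaler_sumr scalerBl scale1r scalerBr addrAC addrA.
Qed.

Lemma convex_hull_cone A v x :
  convex_hull A x -> cone [set p - v | p in A] (x - v).
Proof.
move=> [n [w [p [pA w0 w1 ->]]]].
rewrite (_ : _ - _ = \sum_i w i *: (p i - v)).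
  by apply: cone_sum => // i; apply: cone_gen; exists (p i).
under [RHS]eq_bigr do rewrite scalerBr.
by rewrite sumrB -scaler_suml w1 scale1r.
Qed.

(** Used as a view, to have the functional in the form [dot a]. *)
Lemma face_le P F : is_face P F -> exists a c,
  (forall x, P x -> dot a x <= c) /\ F = [set x | P x /\ dot a x = c].
Proof. by []. Qed.

Lemma face_sub P F : is_face P F -> F `<=` P.
Proof. by move=> [a [c [_ ->]]] x []. Qed.

(** In a convex combination attaining the maximum, the points of nonzero weight
    attain it.  Points of weight zero are replaced by one of nonzero weight. *)
Lemma face_convex_hull A F :
  is_face (convex_hull A) F -> F = convex_hull (A `&` F).
Proof.
case/face_le => a [c [valid defF]].
apply/seteqP; split=> [x|x [n [w [p [pA w0 w1 ->]]]]]; last first.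
  rewrite defF; split; first by exists n, w, p; split=> // i; case: (pA i).
  rewrite dot_sumr -[c]mul1r -w1 mulr_suml; apply: eq_bigr => i _.
  by rewrite dotZr; have [_] := pA i; rewrite defF => -[_ ->].
rewrite {1}defF => -[[n [w [p [pA w0 w1 ->]]]] ax].
have Pp i : convex_hull A (p i) by apply: sub_convex_hull.
have tight i : w i = 0 \/ F (p i).
  have : \sum_i w i * (c - dot a (p i)) = 0.
    under eq_bigr do rewrite mulrBr; rewrite sumrB -mulr_suml w1 mul1r.
    apply/eqP; rewrite subr_eq0 -ax dot_sumr.
    by under [X in _ == X]eq_bigr do rewrite -dotZr.
  have ge0 j : true -> 0 <= w j * (c - dot a (p j)).
    by rewrite mulr_ge0 ?subr_ge0 ?valid.
  move/eqP; rewrite psumr_eq0 // => /allP/(_ i (mem_index_enum _)) /=.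
  rewrite mulf_eq0 subr_eq0 => /orP[/eqP|/eqP e]; first by left.
  by right; rewrite defF; split.
have [j wj] : exists j, w j != 0.
  apply: contrapT => noj; move: w1; rewrite big1 => [/eqP|i _].
    by rewrite eq_sym oner_eq0.
  by apply/eqP/negPn/negP => wi; apply: noj; exists i.
pose q i := if w i == 0 then p j else p i.
have Fq i : F (q i).
  rewrite /q; case: eqP => [_|/eqP/negPf w_i]; last first.
    by case: (tight i) => // /eqP; rewrite w_i.
  by case: (tight j) => // /eqP; rewrite (negPf wj).
exists n, w, q; split=> // [i|].
  by split=> //; rewrite /q; case: ifP.
apply: eq_bigr => i _; rewrite /q; case: eqP => [->|//].
by rewrite !scale0r.
Qed.

(** If [a] cuts out [F] and [b] cuts out [F'] in [F], then [b + M *: a] cuts out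
    [F'] in [P] for large [M]; finitely many points determine how large. *)
Lemma face_trans A P F F' : finite_set A -> P = convex_hull A ->
  is_face P F -> is_face F F' -> is_face P F'.
Proof.
case/finite_seqP => s -> ->.
move=> /face_le[a [c [valid defF]]] /face_le[b [d [valid' ->]]].
have [M [M0 MA]] : exists M, 0 <= M /\
    forall p, p \in s -> dot b p - d <= M * (c - dot a p).
  have : {in s, forall p, dot a p < c \/ dot a p = c /\ dot b p <= d}.
    move=> p ps; have Pp := sub_convex_hull (ps : [set` s] p).
    have := valid p Pp; rewrite le_eqVlt => /orP[/eqP e|]; last by left.
    by right; split=> //; apply: valid'; rewrite defF.
  elim: (s) => [|p s' IH] H; first by exists 0.
  have [q qs|M [M0 MA]] := IH _; first by apply: H; rewrite inE qs orbT.
  have le_c q : q \in p :: s' -> 0 <= c - dot a q.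
    by move=> /H [|[]]; lra.
  have [apc|[apc bp]] := H p (mem_head _ _).
    have cp : 0 < c - dot a p by lra.
    exists (Num.max M ((dot b p - d) / (c - dot a p))).
    split; first by rewrite le_max M0.
    move=> q; rewrite inE => /orP[/eqP ->|qs].
      by rewrite -ler_pdivrMr // le_max lexx orbT.
    apply: le_trans (MA q qs) _; apply: ler_wpM2r; last by rewrite le_max lexx.
    by apply: le_c; rewrite inE qs orbT.
  exists M; split=> // q; rewrite inE => /orP[/eqP ->|]; last exact: MA.
  by rewrite apc subrr mulr0; lra.
have MP x : convex_hull [set` s] x -> dot (b + M *: a) x <= d + M * c.
  apply: convex_hull_le => p /= /MA; rewrite dotDl dotZl; lra.
(* one more copy of a makes equality force dot a x = c *)
exists (b + (M + 1) *: a), (d + (M + 1) * c).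
split=> [x Px|]; rewrite -?/(dot _ _).
  by have := MP x Px; have := valid x Px; rewrite !dotDl !dotZl; lra.
apply/seteqP; split=> x /=.
  by rewrite defF -/(dot _ _) dotDl dotZl => -[[Px ->] <-].
rewrite defF -!/(dot _ _) dotDl dotZl => -[Px e].
have := MP x Px; have := valid x Px.
rewrite dotDl dotZl => v1 v2.
have ac : dot a x = c by lra.
by split=> //; move: e; rewrite ac; lra.
Qed.

Lemma face_of_face P F E : is_face P E -> E `<=` F -> F `<=` P -> is_face F E.
Proof.
move=> [a [c [valid defE]]] EF FP; exists a, c.
split=> [x /FP|]; first exact: valid.
rewrite {1}defE; apply/seteqP; split=> x /= [Px ax]; split=> //; last exact: FP.
by apply: EF; rewrite defE.
Qed.

Lemma vertex_exposed P v : is_vertex P v <->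
  P v /\ exists a, forall x, P x -> x <> v -> dot a x < dot a v.
Proof.
split=> [[a [c [valid E]]]|[Pv [a ltv]]].
  have [Pv av] : P v /\ (v *m a) 0 0 = c.
    by have : [set v] v by []; rewrite E.
  split=> //; exists a => x Px xv; rewrite /dot av lt_neqAle valid // andbT.
  apply/eqP => ax.
  have : [set v] x by rewrite E.
  by [].
exists a, (dot a v); split=> [x Px|].
  by have [->//|/eqP xv] := eqVneq x v; apply/ltW/ltv.
apply/seteqP; split=> [_ ->//|x [Px ax] /=]; apply/eqP/negPn/negP => /eqP xv.
by have := ltv x Px xv; rewrite /dot ax ltxx.
Qed.

Lemma vertex_in P v : is_vertex P v -> P v.
Proof. by case/vertex_exposed. Qed.

Lemma affine_hull_in_vspace F v (U : {vspace 'rV[R]_N}) :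
  (forall y, F y -> y - v \in U) -> forall y, affine_hull F y -> y - v \in U.
Proof.
move=> FU _ [n [w [p [pF w1 ->]]]].
rewrite (_ : _ - _ = \sum_i w i *: (p i - v)).
  by apply: memv_suml => i _; apply/memvZ/FU.
under [RHS]eq_bigr do rewrite scalerBr.
by rewrite sumrB -scaler_suml w1 scale1r.
Qed.

Lemma has_dim_direction F d v : has_dim F d -> F v ->
  exists U : {vspace 'rV[R]_N},
    affine_hull F = [set y | y - v \in U] /\ \dim U = d.
Proof.
move=> [x [U [defF dimU]]] Fv; exists U; split=> //; rewrite defF.
have : affine_hull F v by apply: sub_affine_hull.
rewrite defF /= => xU; apply/seteqP; split=> y /= yU.
  have -> : y - v = (y - x) - (v - x) by rewrite opprB addrA subrK.
  exact: memvB.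
have -> : y - x = (y - v) + (v - x) by rewrite addrA subrK.
exact: memvD.
Qed.

Lemma has_dim_le F d v (W : {vspace 'rV[R]_N}) : has_dim F d -> F v ->
  (forall y, F y -> y - v \in W) -> (d <= \dim W)%N.
Proof.
move=> hd Fv FW; have [U [defF <-]] := has_dim_direction hd Fv.
apply/dimvS/subvP => u uU.
have : affine_hull F (v + u) by rewrite defF /= addrC addKr.
by move/(affine_hull_in_vspace FW); rewrite addrC addKr.
Qed.

Lemma has_dim_span F v (E : seq 'rV[R]_N) : F v ->
  (forall e, e \in E -> F (v + e)) -> (forall y, F y -> y - v \in <<E>>%VS) ->
  has_dim F (\dim <<E>>).
Proof.
move=> Fv FE FW; exists v, <<E>>%VS; split=> //; apply/seteqP; split=> [y|y /=].
  exact: affine_hull_in_vspace.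
rewrite -[E]in_tupleE => /coord_span yE.
pose c := coord (in_tuple E); pose k := 1 - \sum_i c i (y - v).
have -> : y = \sum_(i : unit + 'I_(size E))
    (if i is inr i then c i (y - v) else k)
    *: (if i is inr i then v + E`_i else v).
  rewrite big_sumType /= big_const card_unit /= addr0.
  under eq_bigr do rewrite scalerDr.
  rewrite big_split /= -yE -scaler_suml addrA -scalerDl subrK scale1r.
  by rewrite addrC subrK.
apply: affine_hull_fin => [[_|i]|]; [by []|by apply/FE/mem_nth|].
by rewrite big_sumType /= big_const card_unit /= addr0 subrK.
Qed.

End Hulls.

(** * Edges and vertex cones *)

Section Edges.
Variables (R : realType) (N : nat).
Implicit Types (x y u v w g : 'rV[R]_N) (a b : 'cV[R]_N) (A P F : set 'rV[R]_N).

Definition segment u w : set 'rV[R]_N :=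
  [set x | exists t, 0 <= t <= 1 /\ x = u + t *: (w - u)].

Lemma segment_l u w : segment u w u.
Proof. by exists 0; rewrite lexx ler01 scale0r addr0. Qed.

Lemma segment_r u w : segment u w w.
Proof. by exists 1; rewrite lexx ler01 scale1r addrC subrK. Qed.

Lemma segment_sub A u w : convex_hull A u -> convex_hull A w ->
  segment u w `<=` convex_hull A.
Proof. by move=> Pu Pw x [t [t01 ->]]; apply: convex_hull_convex. Qed.

Lemma segment_has_dim u w : u <> w -> has_dim (segment u w) 1.
Proof.
move=> uw; have e0 : w - u != 0 by rewrite subr_eq0 eq_sym; apply/eqP.
have <- : \dim <<[:: w - u]>> = 1%N by rewrite span_seq1 dim_vline e0.
apply: (has_dim_span (segment_l u w)) => [e|y [t [_ ->]]].
  by rewrite inE => /eqP ->; rewrite addrC subrK; apply: segment_r.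
by rewrite addrC addKr; apply/memvZ/memv_span; rewrite inE.
Qed.

(** Otherwise [v] would lie strictly between two points of [P]. *)
Lemma vertex_ray_ge0 P v g t s : is_vertex P v -> 0 < s -> g != 0 ->
  P (v + s *: g) -> P (v + t *: g) -> 0 <= t.
Proof.
move=> /vertex_exposed[Pv [a av]] s0 g0 Ps Pt; rewrite leNgt; apply/negP => t0.
have ne r : r != 0 -> v + r *: g <> v.
  move=> r0 /eqP; rewrite -subr_eq0 addrC addKr.
  by rewrite scaler_eq0 (negPf r0) (negPf g0).
have := av _ Ps (ne _ (lt0r_neq0 s0)); have := av _ Pt (ne _ (ltr0_neq0 t0)).
rewrite !dotDr !dotZr => h1 h2.
have : s * dot a g < 0 by lra.
rewrite pmulr_rlt0 // => ag.
have : t * dot a g < 0 by lra.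
by rewrite nmulr_rlt0 // ltNge (ltW ag).
Qed.

Lemma segment_inj v w w' : v <> w -> segment v w = segment v w' -> w = w'.
Proof.
move=> vw E; have g0 : w - v != 0 by rewrite subr_eq0 eq_sym; apply/eqP.
have : segment v w w' by rewrite E; apply: segment_r.
have : segment v w' w by rewrite -E; apply: segment_r.
move=> [s [/andP[s0 s1] ws]] [t [/andP[t0 t1] w't]].
have : (1 - s * t) *: (w - v) = 0.
  have e1 : w - v = s *: (w' - v) by rewrite {1}ws addrC addKr.
  have e2 : w' - v = t *: (w - v) by rewrite {1}w't addrC addKr.
  by rewrite scalerBl scale1r -scalerA -e2 -e1 subrr.
move/eqP; rewrite scaler_eq0 (negPf g0) orbF => /eqP st.
have := ler_piMl t0 s1 => le.
have t_1 : t = 1 by lra.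
by rewrite w't t_1 scale1r addrC subrK.
Qed.

Lemma edge_line P F v w : is_edge P F -> F v -> F w -> v <> w ->
  forall x, F x -> exists t, x = v + t *: (w - v).
Proof.
move=> [fF dF] Fv Fw vw x Fx.
have [U [defF dimU]] := has_dim_direction dF Fv.
have FU y : F y -> y - v \in U by move/(@sub_affine_hull _ _ _); rewrite defF.
have /eqP defU : <[w - v]>%VS == U.
  rewrite eqEdim -memvE FU //= dimU dim_vline subr_eq0 lt0b.
  by apply/eqP => e; apply: vw.
have := FU _ Fx; rewrite -defU => /vlineP[t e].
by exists t; rewrite -e addrC subrK.
Qed.

Lemma edge_joinsE A u w (P := convex_hull A) : edge_joins P u w <->
  [/\ is_vertex P u, is_vertex P w, u <> w & is_face P (segment u w)].
Proof.
split=> [[Vu Vw uw [F [eF Fu Fw]]]|[Vu Vw uw fs]]; last first.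
  split=> //; exists (segment u w).
  split; [split=> //|exact: segment_l|exact: segment_r].
  exact: segment_has_dim.
split=> //; have fF := eF.1; suff <- : F = segment u w by [].
have FP := face_sub fF; apply/seteqP; split=> x; last first.
  have := face_convex_hull fF => EF; rewrite EF in Fu Fw *.
  exact: segment_sub.
move=> Fx; have [t xt] := edge_line eF Fu Fw uw Fx; exists t; split=> //.
have g0 : w - u != 0 by rewrite subr_eq0 eq_sym; apply/eqP.
apply/andP; split.
  apply: (@vertex_ray_ge0 _ _ (w - u) t 1 Vu) => //.
    by rewrite scale1r addrC subrK; apply: FP.
  by rewrite -xt; apply: FP.
rewrite -subr_ge0.
apply: (@vertex_ray_ge0 _ _ (u - w) (1 - t) 1 Vw) => //.
- by rewrite subr_eq0; apply/eqP.
- by rewrite scale1r addrC subrK; apply: FP.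
suff -> : w + (1 - t) *: (u - w) = x by apply: FP.
rewrite xt -[u - w]opprB scalerN scalerBl scale1r opprB addrA (addrC w) -addrA.
by rewrite opprB (addrC w) subrK addrC.
Qed.

(** The far end [w] is the lowest generating point of [F] for the functional
    [a] that exposes [v]; as [- a] exposes [w] in [F], it is a vertex of [P]. *)
Lemma ray_face A P F v g : finite_set A -> P = convex_hull A ->
    is_vertex P v -> is_face P F -> F v ->
    (forall x, F x -> exists t, 0 <= t /\ x = v + t *: g) ->
    (exists2 p, F p & p <> v) ->
  exists w, edge_joins P v w /\ F = segment v w.
Proof.
move=> finA defP Vv fF Fv Fray [p Fp pv].
have FA : F = convex_hull (A `&` F) by apply: face_convex_hull; rewrite -defP.
have /finite_seqP[s sE] : finite_set (A `&` F) by apply: finite_setIl.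
rewrite sE in FA.
have Fs q : q \in s -> F q by move=> qs; rewrite FA; apply: sub_convex_hull.
have FP := face_sub fF.
have [_ [a av]] := (vertex_exposed P v).1 Vv.
have s0 : exists q, q \in s.
  move: Fp; rewrite FA => -[n [w [q [qs _ w1 _]]]].
  case: n w q qs w1 => [|n] w q qs w1.
    by move: w1; rewrite big_ord0 => /eqP; rewrite eq_sym oner_eq0.
  by exists (q ord0); apply: (qs ord0).
have [w ws wmin] : exists2 w, w \in s & forall q, q \in s -> dot a w <= dot a q.
  case: s0; elim: (s) => [//|q s' IH] _ _.
  case: s' IH => [|q' s'] IH.
    by exists q; rewrite ?mem_head // => r; rewrite inE => /eqP ->.
  have [w ws wmin] := IH q' (mem_head _ _).
  have [le|lt] := leP (dot a w) (dot a q).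
    exists w => [|r]; rewrite inE ?ws ?orbT // => /orP[/eqP ->//|].
    exact: wmin.
  exists q => [|r]; rewrite ?mem_head // inE => /orP[/eqP ->//|/wmin]; lra.
have Fmin x : F x -> dot a w <= dot a x.
  move=> Fx; suff : dot (- a) x <= - dot a w by rewrite dotNl; lra.
  rewrite FA in Fx; apply: convex_hull_le Fx => q /= /wmin; rewrite dotNl; lra.
have Fw := Fs w ws.
have lt_p : dot a p < dot a v by apply: av => //; apply: FP.
have wv : w <> v by move=> e; have := Fmin p Fp; rewrite e; lra.
have lt_w : dot a w < dot a v by apply: av => //; apply: FP.
have ne : dot a v - dot a w != 0 by rewrite gt_eqF //; lra.
have [tw [tw0 w_t]] := Fray w Fw.
have wt : w - v = tw *: g by rewrite w_t addrC addKr.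
have twg : tw * dot a g = dot a w - dot a v by rewrite -dotBr wt dotZr.
have tw_neq0 : tw != 0 by apply/eqP => e; move: twg; rewrite e mul0r; lra.
have defF : F = segment v w.
  apply/seteqP; split=> x; last first.
    by rewrite FA in Fv Fw *; apply: segment_sub.
  move=> Fx; have [t [t0 xt]] := Fray x Fx; exists (t / tw).
  have ax := Fmin x Fx.
  have txg : t * dot a g = dot a x - dot a v.
    by rewrite -dotBr xt [v + _]addrC addrK dotZr.
  split; last by rewrite wt scalerA divfK.
  rewrite divr_ge0 //= ler_pdivrMr ?lt0r ?tw_neq0 // mul1r leNgt.
  apply/negP => lt; have ag : dot a g < 0.
    by rewrite -(pmulr_rlt0 _ (_ : 0 < tw)) ?twg ?lt0r ?tw_neq0 //; lra.
  have : t * dot a g < tw * dot a g by rewrite ltr_nM2r.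
  lra.
exists w; split=> //.
have Vw : is_vertex P w.
  apply: (face_trans finA defP fF); apply/vertex_exposed; split=> //.
  exists (- a) => x Fx xw; rewrite !dotNl ltrN2 lt_neqAle Fmin // andbT.
  apply/eqP => e; apply: xw; move: Fx; rewrite defF => -[t [_ xt]].
  have := congr1 (dot a) xt; rewrite dotDr dotZr dotBr -e => E.
  have : (t - 1) * (dot a w - dot a v) = 0 by lra.
  move/eqP; rewrite mulf_eq0 => /orP[].
    by rewrite subr_eq0 => /eqP t1; rewrite xt t1 scale1r addrC subrK.
  by rewrite subr_eq0 lt_eqF.
rewrite {1}defP; apply/edge_joinsE; rewrite -defP -defF; split=> //.
exact: nesym.
Qed.

(** The cone at a vertex is generated by its extreme rays; each of these is
    exposed by a functional, so it cuts out an edge of [P]. *)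
Lemma vertex_cone A P v : finite_set A -> P = convex_hull A -> is_vertex P v ->
  forall x, P x -> cone [set w - v | w in [set w | edge_joins P v w]] (x - v).
Proof.
move=> finA defP Vv x Px; have [s sA] := (finite_seqP A).1 finA.
have [Pv [a av]] := (vertex_exposed P v).1 Vv.
pose s0 := [seq p - v | p <- s & p != v].
have As q : q \in s -> P q.
  by move=> qs; rewrite defP; apply: sub_convex_hull; rewrite sA.
have as0 h : h \in s0 -> dot a h < 0.
  move=> /mapP[p]; rewrite mem_filter => /andP[/eqP pv ps] ->.
  by rewrite dotBr subr_lt0; apply: av => //; apply: As.
have [s' [s's cs' bs']] := irredundant_generators as0.
have Pcone y : P y -> cone [set` s'] (y - v).
  rewrite defP => /(@convex_hull_cone _ _ _ v); apply: cone_cone => _ [p Ap <-].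
  have [->|pv] := eqVneq p v; first by rewrite subrr; apply: cone0.
  apply: cs' => /=; apply: map_f; rewrite mem_filter pv.
  by move: Ap; rewrite sA.
apply: cone_cone (Pcone x Px) => g /= gs.
have [b [bg bs]] := bs' g gs.
have bs0 h : [set` s'] h -> dot b h <= 0.
  by move=> /= hs; have [->|hg] := eqVneq h g; [rewrite bg | apply/ltW/bs].
pose F := [set y | P y /\ dot b y = dot b v].
have fF : is_face P F.
  exists b, (dot b v); split=> // y /Pcone /(cone_dot_le0 bs0).
  by rewrite dotBr subr_le0.
have [p ps gp] : exists2 p, P p /\ p <> v & g = p - v.
  have /mapP[p] := s's g gs; rewrite mem_filter => /andP[/eqP pv ps] ->.
  by exists p => //; split=> //; apply: As.
have ray c : cone ([set` s'] `&` [set h | dot b h = 0]) c ->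
    exists t, 0 <= t /\ c = t *: g.
  elim=> [|u h c' u0 [/= hs bh] _ [t [t0 ->]]].
    by exists 0; rewrite scale0r.
  have -> : h = g by apply/eqP/negPn/negP => /(bs h hs); rewrite bh ltxx.
  by exists (u + t); rewrite scalerDl addr_ge0.
have Fp : F p.
  split; first exact: ps.1.
  by move: bg; rewrite gp dotBr => /eqP; rewrite subr_eq0 => /eqP.
have [|||w [ew EF]] := ray_face finA defP Vv fF _ _ _ (g := g).
- by split.
- move=> y [Py by_]; have [|t [t0 yt]] := ray (y - v).
    by apply: cone_dot_eq0 => //; [exact: Pcone | rewrite dotBr by_ subrr].
  by exists t; rewrite -yt addrC subrK.
- by exists p => //; exact: ps.2.
move: Fp; rewrite EF => -[t [/andP[t0 _] pt]]; rewrite gp pt addrC addKr.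
by apply: coneZ => //; apply: cone_gen; exists w.
Qed.

End Edges.

Section EdgeCount.
Variables (R : realType) (N : nat) (X : sgraph).
Variables (A P : set 'rV[R]_N) (f : X -> 'rV[R]_N).
Hypotheses (finA : finite_set A) (defP : P = convex_hull A).
Hypothesis f_vertices : set_bij [set: X] [set v | is_vertex P v] f.
Hypothesis f_edges : forall x y : X, gadj x y <-> edge_joins P (f x) (f y).

Lemma vertex_f x : is_vertex P (f x).
Proof. by have [+ _ _] := f_vertices; apply. Qed.

Lemma f_inj : injective f.
Proof.
by have [_ inj _] := f_vertices; move=> x y /inj; apply; rewrite in_setT.
Qed.

Lemma f_surj v : is_vertex P v -> exists x, v = f x.
Proof. by have [_ _ surj] := f_vertices => /surj[x _ <-]; exists x. Qed.

(** Every edge at a vertex is a segment to an adjacent vertex, by [ray_face]. *)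
Lemma card_edges_at x :
  ([set F | is_edge P F /\ F (f x)] #= `I_#|nbrs x|)%card.
Proof.
rewrite card_eq_sym (card_eql card_II); apply/card_set_bijP.
exists (fun i => segment (f x) (f (enum_val i))).
have adj (i : 'I_#|nbrs x|) : edge_joins P (f x) (f (enum_val i)).
  by apply/f_edges; have := enum_valP i; rewrite inE.
split=> [i _|i j _ _|F [eF Fx]] /=.
- have := adj i; rewrite {1}defP => /edge_joinsE; rewrite -defP => -[_ _ ne fs].
  split; last exact: segment_l.
  by split=> //; apply: segment_has_dim.
- move=> E; suff : f (enum_val i) = f (enum_val j) by move/f_inj/enum_val_inj.
  by have [_ _ ne _] := adj i; apply: segment_inj ne E.
have [p Fp px] : exists2 p, F p & p <> f x.
  apply: contrapT => nop; have := has_dim_le eF.2 Fx (W := 0%VS).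
  rewrite dimv0 => H; suff : (1 <= 0)%N by []; apply: H => y Fy.
  rewrite memv0 subr_eq0; apply/eqP; apply: contrapT => ne; apply: nop.
  by exists y.
have Vx := vertex_f x; have g0 : p - f x != 0 by rewrite subr_eq0; apply/eqP.
have FP := face_sub eF.1.
have [||w [ew EF]] := ray_face finA defP Vx eF.1 Fx _ _ (g := p - f x).
- move=> y Fy; have [t yt] := edge_line eF Fx Fp (nesym px) Fy; exists t.
  split=> //; apply: (vertex_ray_ge0 Vx ltr01 g0 (t := t)).
    by rewrite scale1r addrC subrK; apply: FP.
  by rewrite -yt; apply: FP.
- by exists p.
have [y wy] : exists y, w = f y by apply: f_surj; case: ew.
have adjy : y \in nbrs x by rewrite inE; apply/f_edges; rewrite -wy.
by exists (enum_rank_in adjy y) => //; rewrite enum_rankK_in // EF wy.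
Qed.

End EdgeCount.

(** * Functionals in general position *)

Section Generic.
Variables (R : realType) (N : nat).
Implicit Types (a b : 'cV[R]_N) (s : seq 'rV[R]_N).

Lemma small_perturbation s b c : exists2 eps : R, 0 < eps &
  forall k, k \in s -> dot b k != 0 -> eps * `|dot c k| < `|dot b k|.
Proof.
elim: s => [|h s [eps eps0 IH]]; first by exists 1.
have [bh|bh] := eqVneq (dot b h) 0.
  exists eps => // k; rewrite inE => /orP[/eqP ->|]; last exact: IH.
  by rewrite bh eqxx.
pose e := `|dot b h| / (`|dot c h| + 1).
have c1 : 0 < `|dot c h| + 1 by rewrite ltr_wpDl.
have e0 : 0 < e by rewrite divr_gt0 ?normr_gt0.
exists (Num.min eps e); first by rewrite lt_min eps0.
move=> k; rewrite inE => /orP[/eqP -> _|ks bk]; last first.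
  by apply: le_lt_trans (IH k ks bk); rewrite ler_wpM2r // ge_min lexx.
apply: (@le_lt_trans _ _ (e * `|dot c h|)).
  by rewrite ler_wpM2r // ge_min lexx orbT.
by rewrite /e mulrAC ltr_pdivrMr // ltr_pM2l ?normr_gt0 // ltrDl.
Qed.

(** Treat the vectors one by one: if the current functional vanishes at [h],
    add a multiple of [h^T], which is positive at [h], small enough to preserve
    the signs obtained so far. *)
Lemma generic_functional s a : exists b,
  (forall h, h \in s -> h != 0 -> dot b h != 0) /\
  (forall h, h \in s -> dot a h < 0 -> dot b h < 0).
Proof.
suff : forall s0 : seq 'rV[R]_N,
  exists b, (forall h, h \in s0 -> h != 0 -> dot b h != 0) /\
  (forall h, h \in s -> dot a h < 0 -> dot b h < 0) by apply.
elim=> [|h s0 [b [b0 bs]]]; first by exists a.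
have [/andP[h0 /eqP bh]|nh] := boolP ((h != 0) && (dot b h == 0)); last first.
  exists b; split=> // k; rewrite inE => /orP[/eqP -> h0|]; last exact: b0.
  by move: nh; rewrite h0.
have [eps eps0 Heps] := small_perturbation (s0 ++ s) b h^T.
exists (b + eps *: h^T).
have small k : k \in s0 ++ s -> dot b k != 0 -> `|eps * dot h^T k| < `|dot b k|.
  by move=> ks bk; rewrite normrM (gtr0_norm eps0); apply: Heps.
split=> k; rewrite dotDl dotZl.
  rewrite inE => /orP[/eqP -> _|ks k0].
    by rewrite bh add0r mulf_neq0 ?lt0r_neq0 ?dot_trmx_gt0.
  have bk := b0 k ks k0; have := small k; rewrite mem_cat ks => /(_ isT bk) lt.
  apply/eqP => /eqP; rewrite addr_eq0 => /eqP e.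
  by move: lt; rewrite e normrN ltxx.
move=> ks /(bs k ks) bk.
have := small k; rewrite mem_cat ks orbT => /(_ isT (ltr0_neq0 bk)).
by rewrite (ltr0_norm bk) => /(le_lt_trans (ler_norm _)); lra.
Qed.

End Generic.

(** * The face system of a simple polytope *)

Section SimplePolytope.
Variables (R : realType) (N : nat) (X : sgraph) (d : nat).
Variables (A P : set 'rV[R]_N) (f : X -> 'rV[R]_N).
Hypotheses (finA : finite_set A) (defP : P = convex_hull A).
Hypothesis f_vertices : set_bij [set: X] [set v | is_vertex P v] f.
Hypothesis f_edges : forall x y : X, gadj x y <-> edge_joins P (f x) (f y).
Hypotheses (dimP : has_dim P d) (degX : forall x : X, #|nbrs x| = d).
Implicit Types (S : {set X}).

Let finj : injective f := f_inj f_vertices.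

Let Pf x : P (f x).
Proof. by apply: vertex_in; apply: (vertex_f f_vertices). Qed.

Definition vertex_faces : {set {set X}} :=
  [set S | `[< exists a c, (forall p, P p -> dot a p <= c) /\
                 S = [set y | dot a (f y) == c]%SET >]]%SET.

Lemma vertex_facesP S : reflect
  (exists a c, (forall p, P p -> dot a p <= c) /\
     forall y, (y \in S) = (dot a (f y) == c))
  (S \in vertex_faces).
Proof.
rewrite inE; apply: (iffP (asboolP _)) => -[a [c [valid defS]]];
  exists a, c; split=> //.
  by move=> y; rewrite defS inE.
by apply/setP => y; rewrite inE.
Qed.

Definition directions x S := [seq f u - f x | u <- enum (nbrs x :&: S)%SET].

Lemma directionsP x S e :
  reflect (exists u, [/\ u \in nbrs x, u \in S & e = f u - f x])
    (e \in directions x S).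
Proof.
apply: (iffP mapP) => -[u].
  by rewrite mem_enum finset.in_setI => /andP[? ?] ->; exists u.
by move=> [? ? ->]; exists u; rewrite ?mem_enum ?finset.in_setI //; apply/andP.
Qed.

Lemma cone_neighbors x p :
  P p -> cone [set` directions x finset.setT] (p - f x).
Proof.
move=> /(vertex_cone finA defP (vertex_f f_vertices x)); apply: cone_sub.
move=> _ [w ew <-] /=.
have [u wu] := f_surj f_vertices (match ew with And4 _ v _ _ => v end).
apply/directionsP; exists u; rewrite !inE wu; split=> //.
by apply/f_edges; rewrite -wu.
Qed.

(** The edge directions at a vertex span the directions of [P], and there are
    only [d] of them. *)
Lemma directions_free x S : free (directions x S).
Proof.
have : free (directions x finset.setT).
  rewrite /free eqn_leq dim_span size_map -cardE finset.setIT degX.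
  apply: (has_dim_le dimP (Pf x)) => p /(cone_neighbors x).
  by apply: cone_in_vspace => g /= /memv_span.
suff : perm_eq (directions x finset.setT)
    (directions x S ++ directions x (~: S)%SET).
  by move/perm_free ->; apply: catl_free.
rewrite -map_cat perm_map // uniq_perm ?cat_uniq ?enum_uniq //=.
  rewrite andbT; apply/hasPn => u; rewrite !mem_enum !inE => /andP[_].
  by apply: contra => /andP[].
by move=> u; rewrite mem_cat !mem_enum !inE -andb_orr orbN.
Qed.

Lemma dim_directions x S : \dim <<directions x S>> = #|(nbrs x :&: S)%SET|.
Proof. by move/eqP: (directions_free x S) => ->; rewrite size_map -cardE. Qed.

(** In the conic combination of the edges at [x] that gives [p - f x], the
    functional [a] is nonpositive on all edges and zero on the sum. *)
Lemma face_cone a c S x p : (forall p, P p -> dot a p <= c) ->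
  (forall y, (y \in S) = (dot a (f y) == c)) -> x \in S ->
  P p -> dot a p = c -> cone [set` directions x S] (p - f x).
Proof.
move=> valid defS xS Pp ap.
have ax : dot a (f x) = c by apply/eqP; rewrite -defS.
have le0 e : [set` directions x finset.setT] e -> dot a e <= 0.
  by move=> /= /directionsP[u [_ _ ->]]; rewrite dotBr subr_le0 ax valid.
have := cone_dot_eq0 le0 (cone_neighbors x Pp).
rewrite dotBr ap ax subrr => /(_ erefl); apply: cone_sub => e [/= + ae].
case/directionsP => u [ux _ eu]; apply/directionsP; exists u; split=> //.
by rewrite defS; move: ae; rewrite eu dotBr ax => /eqP; rewrite subr_eq0.
Qed.

(** Take the functional that is 0 on the chosen edges and -1 on the others. *)
Lemma spanned_face x (I : {set X}) : I \subset nbrs x ->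
  exists S, [/\ S \in vertex_faces, x \in S & (nbrs x :&: S)%SET = I].
Proof.
move=> /fintype.subsetP sI; pose D := [seq f u - f x | u <- enum I].
have [a aE] := free_interpolate (fun e => if e \in D then 0 else -1)
  (directions_free x finset.setT).
have adir u : u \in nbrs x -> dot a (f u - f x) = if u \in I then 0 else -1.
  move=> ux; rewrite aE; last first.
    by apply/directionsP; exists u; rewrite finset.in_setT.
  rewrite /= (mem_map (f := fun u => f u - f x)) ?mem_enum //.
  by move=> y z /(congr1 (fun v => v + f x)); rewrite !subrK => /finj.
have valid p : P p -> dot a p <= dot a (f x).
  move=> /(cone_neighbors x) cp; rewrite -subr_le0 -dotBr.
  apply: cone_dot_le0 cp => e /= /directionsP[u [ux _ ->]].
  by rewrite adir //; case: ifP => _; rewrite ?lexx ?lerN10.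
exists [set y | dot a (f y) == dot a (f x)]%SET; split.
- by apply/vertex_facesP; exists a, (dot a (f x)); split=> // y; rewrite inE.
- by rewrite inE.
apply/setP => u; rewrite finset.in_setI [in X in _ && X]inE -subr_eq0 -dotBr.
have [ux|nux] /= := boolP (u \in nbrs x).
  by rewrite adir //; case: ifP => _; rewrite ?eqxx // oppr_eq0 oner_eq0.
by apply/esym; apply: contraNF nux; apply: sI.
Qed.

Lemma vertex_face_mono S S' x : S \in vertex_faces -> S' \in vertex_faces ->
  x \in S -> x \in S' -> (nbrs x :&: S)%SET \subset S' -> S \subset S'.
Proof.
case/vertex_facesP => a [c [valid defS]] /vertex_facesP[b [e [valid' defS']]].
move=> xS xS' /fintype.subsetP sub; apply/fintype.subsetP => z zS.
have bx : dot b (f x) = e by apply/eqP; rewrite -defS'.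
have cz : cone [set` directions x S] (f z - f x).
  by apply: (face_cone valid defS xS) => //; apply/eqP; rewrite -defS.
have dir0 g : [set` directions x S] g -> dot b g = 0.
  move=> /= /directionsP[u [ux uS ->]].
  have : u \in S' by apply: sub; rewrite finset.in_setI ux.
  by rewrite defS' dotBr bx => /eqP ->; rewrite subrr.
rewrite defS' eq_le valid' //= -bx -subr_ge0 -dotBr -oppr_le0 -dotNl.
by apply: cone_dot_le0 cz => g /dir0; rewrite dotNl => ->; rewrite oppr0.
Qed.

(** The degree in a face is the dimension of the span of the edge directions,
    which is the direction space of the face at each of its vertices. *)
Lemma vertex_face_regular S x y : S \in vertex_faces -> x \in S -> y \in S ->
  #|(nbrs x :&: S)%SET| = #|(nbrs y :&: S)%SET|.
Proof.
case/vertex_facesP => a [c [valid defS]].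
suff le x' y' : x' \in S -> y' \in S ->
    (#|(nbrs y' :&: S)%SET| <= #|(nbrs x' :&: S)%SET|)%N.
  by move=> xS yS; apply/eqP; rewrite eqn_leq !le.
move=> xS yS; rewrite -!dim_directions.
apply/dimvS/span_subvP => _ /directionsP[u [_ uS ->]].
have inx z : z \in S -> f z - f x' \in <<directions x' S>>%VS.
  move=> zS.
  have /(cone_in_vspace _) : cone [set` directions x' S] (f z - f x').
    by apply: (face_cone valid defS xS) => //; apply/eqP; rewrite -defS.
  by apply=> g /= /memv_span.
have -> : f u - f y' = (f u - f x') - (f y' - f x').
  by rewrite opprB addrA subrK.
by rewrite memvB ?inx.
Qed.

Lemma vertex_face_sink x : exists phi : X -> R,
  [/\ injective phi, forall z, phi z <= phi x & unimodal vertex_faces phi].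
Proof.
have [_ [a ax]] := (vertex_exposed P (f x)).1 (vertex_f f_vertices x).
pose s := [seq f p.1 - f p.2 | p : X * X].
have sP y z : f y - f z \in s by apply/mapP; exists (y, z); rewrite ?mem_enum.
have [b [b0 bs]] := generic_functional s a.
exists (fun y => dot b (f y)); split.
- move=> y z e; apply/finj/eqP; rewrite -subr_eq0; apply/negPn/negP.
  by move/(b0 _ (sP y z)); rewrite dotBr e subrr eqxx.
- move=> z; have [->//|zx] := eqVneq z x; apply/ltW.
  rewrite -subr_lt0 -dotBr bs // dotBr subr_lt0; apply: ax => //.
  by move=> /finj /eqP; apply/negP.
move=> S y /vertex_facesP[c [e [valid defS]]] yS top z zS.
have cz : cone [set` directions y S] (f z - f y).
  by apply: (face_cone valid defS yS) => //; apply/eqP; rewrite -defS.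
rewrite -subr_le0 -dotBr.
apply: cone_dot_le0 cz => g /= /directionsP[u [uy uS ->]].
by rewrite dotBr subr_le0 top // finset.in_setI uy.
Qed.

Lemma vertex_face_system : @face_system R X vertex_faces.
Proof.
split; [exact: spanned_face|exact: vertex_face_mono|exact: vertex_face_regular
       |exact: vertex_face_sink|].
by apply/vertex_facesP; exists 0, 0; split=> [p _|y]; rewrite dot0l // inE eqxx.
Qed.

(** The vertices and edges of a face are those of [P] that it contains, and its
    dimension is the number of its edges at any of its vertices. *)
Lemma vertex_face_polytopal S (Y : sgraph) (rho : Y -> X) :
  S \in vertex_faces -> injective rho ->
  (forall x, x \in S <-> exists y, x = rho y) ->
  (forall y z, gadj y z = gadj (rho y) (rho z)) -> simply_polytopal R Y.
Proof.
move=> SP rho_inj rhoS rho_adj; have [a [c [valid defS]]] := vertex_facesP _ SP.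
pose F := [set p | P p /\ dot a p = c].
have fF : is_face P F by exists a, c.
have FP := face_sub fF.
have rS y : rho y \in S by apply/rhoS; exists y.
have Ff x : F (f x) <-> x \in S.
  by split=> [[_ e]|]; rewrite defS; [apply/eqP | move/eqP; split].
have finAF : finite_set (A `&` F) by apply: finite_setIl.
have defF : F = convex_hull (A `&` F) by apply: face_convex_hull; rewrite -defP.
have vertexF v : is_vertex F v <-> is_vertex P v /\ F v.
  split=> [vF|[vP Fv]].
    by split; [exact: (face_trans finA defP fF vF) | exact: vertex_in].
  by apply: (face_of_face vP) => // _ ->.
have edgeF u w : F u -> F w -> edge_joins P u w <-> edge_joins F u w.
  move=> Fu Fw; rewrite {1}defP {1}defF !edge_joinsE -defP -defF.
  have sF : segment u w `<=` F.
    by rewrite defF; apply: segment_sub; rewrite -defF.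
  split=> -[/[dup] Vu ? /[dup] Vw ? uw fs]; split=> //.
  - exact/vertexF.
  - exact/vertexF.
  - exact: face_of_face fs _ _.
  - by case/vertexF: Vu.
  - by case/vertexF: Vw.
  - exact: face_trans finA defP fF fs.
have g_edges y z : gadj y z <-> edge_joins F (f (rho y)) (f (rho z)).
  by rewrite rho_adj -edgeF ?Ff.
have g_vertices : set_bij [set: Y] [set v | is_vertex F v] (f \o rho).
  split=> [y _|y z _ _ /finj/rho_inj //|
           v /= /vertexF[/(f_surj f_vertices)[x ->]]] /=.
    by apply/vertexF; split; [exact: (vertex_f f_vertices) | apply/Ff].
  by move/Ff/rhoS => [y ->]; exists y.
have degE y : #|nbrs y| = #|(nbrs (rho y) :&: S)%SET|.
  rewrite -(card_imset _ rho_inj); apply: eq_card => x; rewrite finset.in_setI.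
  apply/imsetP/andP => [[z yz ->]|[+ /rhoS[z xz]]].
    by rewrite rS; move: yz; rewrite !inE rho_adj.
  by rewrite xz !inE -rho_adj => yz; exists z; rewrite ?inE.
have [y0 _] := card_gt0P (gvertex_gt0 Y).
exists #|nbrs y0|, N, F; split; last by exists (f \o rho).
split; first split.
- by exists (A `&` F).
- rewrite degE -dim_directions.
  apply: has_dim_span (_ : F (f (rho y0))) _ _; first exact/Ff.
    by move=> _ /directionsP[u [_ uS ->]]; rewrite addrC subrK; apply/Ff.
  move=> p [Pp ap]; apply: cone_in_vspace (face_cone valid defS (rS y0) Pp ap).
  by move=> g /= /memv_span.
move=> v /(f_surj g_vertices)[y ->].
have := card_edges_at finAF defF g_vertices g_edges y.
by rewrite degE (vertex_face_regular SP (rS y) (rS y0)) -degE.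
Qed.

End SimplePolytope.

(** * Fibers of simply polytopal products *)

Section SimpleFaces.
Variables (R : realType).

Lemma simple_polytope_degree N (X : sgraph) d (P : set 'rV[R]_N)
    (f : X -> 'rV[R]_N) :
  is_simple_dpolytope d P -> set_bij [set: X] [set v | is_vertex P v] f ->
  (forall x y : X, gadj x y <-> edge_joins P (f x) (f y)) ->
  forall x : X, #|nbrs x| = d.
Proof.
move=> [[[A [finA defP]] _] simP] fv fe x; apply/card_eq_II.
apply: card_eq_trans (simP _ (vertex_f fv x)); rewrite card_eq_sym.
exact: card_edges_at finA defP fv fe x.
Qed.

(** The interface between geometry and combinatorics: every face of the
    combinatorial system realizes the graph that it induces. *)
Lemma simply_polytopal_face_system (X : sgraph) : simply_polytopal R X ->
  exists FF : {set {set X}}, face_system R FF /\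
    forall (S : {set X}) (Y : sgraph) (rho : Y -> X), S \in FF ->
      injective rho -> (forall x, x \in S <-> exists y, x = rho y) ->
      (forall y z, gadj y z = gadj (rho y) (rho z)) -> simply_polytopal R Y.
Proof.
move=> [d [N [P [simP [f [fv fe]]]]]].
have degX := simple_polytope_degree simP fv fe.
have [[[A [finA defP]] dimP] _] := simP.
exists (vertex_faces P f).
split; first exact: (vertex_face_system finA defP fv fe dimP degX).
by move=> S Y rho; apply: (vertex_face_polytopal finA defP fv fe dimP degX).
Qed.

(** The whole vertex set is a face. *)
Lemma simply_polytopal_iso (X Y : sgraph) (rho : Y -> X) : bijective rho ->
  (forall y z, gadj y z = gadj (rho y) (rho z)) ->
  simply_polytopal R X -> simply_polytopal R Y.
Proof.
move=> bij_rho adj /simply_polytopal_face_system[FF [FFP Fpoly]].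
apply: (Fpoly _ _ rho (fs_whole FFP)) => //; first exact: bij_inj.
move=> x; rewrite finset.in_setT; split=> // _.
by have [rho' _ rhoK] := bij_rho; exists (rho' x); rewrite rhoK.
Qed.

Lemma simply_polytopal_cprodl (G H : sgraph) :
  simply_polytopal R (cprod G H) -> simply_polytopal R G.
Proof.
move=> /simply_polytopal_face_system[FF [FFP Fpoly]].
have [b0 _] := card_gt0P (gvertex_gt0 H).
apply: (Fpoly _ _ (fun a => (a, b0) : cprod G H) (fiber_face FFP b0)).
- by move=> a a' [].
- move=> [a b]; rewrite inE /=; split=> [/eqP -> | [a' [_ ->]]] //.
  by exists a.
- by move=> a a'; rewrite /= /cprod_adj /= gadj_irr andbF eqxx.
Qed.

Lemma simply_polytopal_cprodC (G H : sgraph) :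
  simply_polytopal R (cprod G H) -> simply_polytopal R (cprod H G).
Proof.
pose swap (x : cprod H G) : cprod G H := (x.2, x.1).
apply: (@simply_polytopal_iso _ _ swap).
  by exists (fun x => (x.2, x.1)); case.
by move=> x y; rewrite /= /cprod_adj /= orbC.
Qed.

End SimpleFaces.

(** * Products of polytopes *)

Section Products.
Variables (R : realType) (N M : nat).
Implicit Types (P F : set 'rV[R]_N) (Q E : set 'rV[R]_M).

Definition set_row_mx P Q : set 'rV[R]_(N + M) :=
  [set z | P (lsubmx z) /\ Q (rsubmx z)].

Lemma set_row_mxE P Q x y : set_row_mx P Q (row_mx x y) <-> P x /\ Q y.
Proof. by rewrite /set_row_mx /= row_mxKl row_mxKr. Qed.

Lemma dot_col_mx (a : 'cV[R]_N) (b : 'cV[R]_M) z :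
  dot (col_mx a b) z = dot a (lsubmx z) + dot b (rsubmx z).
Proof. by rewrite -{1}[z]hsubmxK /dot mul_row_col mxE. Qed.

Lemma row_mx_sum n m (w : 'I_n -> R) (p : 'I_n -> 'rV[R]_N)
    (w' : 'I_m -> R) (q : 'I_m -> 'rV[R]_M) :
  \sum_i w i = 1 -> \sum_j w' j = 1 ->
  row_mx (\sum_i w i *: p i) (\sum_j w' j *: q j)
  = \sum_(k : 'I_n * 'I_m) (w k.1 * w' k.2) *: row_mx (p k.1) (q k.2).
Proof.
move=> w1 w1'; rewrite -[RHS]hsubmxK; congr row_mx.
  rewrite linear_sum.
  rewrite -(pair_bigA _ (fun i j =>
    lsubmx ((w i * w' j) *: row_mx (p i) (q j)))) /=.
  apply: eq_bigr => i _; under [RHS]eq_bigr do rewrite linearZ /= row_mxKl.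
  by rewrite -scaler_suml -mulr_sumr w1' mulr1.
rewrite linear_sum.
rewrite -(pair_bigA _ (fun i j =>
  rsubmx ((w i * w' j) *: row_mx (p i) (q j)))) /=.
rewrite exchange_big /=; apply: eq_bigr => j _.
under [RHS]eq_bigr do rewrite linearZ /= row_mxKr.
by rewrite -scaler_suml -mulr_suml w1 mul1r.
Qed.

Lemma sum_weights n m (w : 'I_n -> R) (w' : 'I_m -> R) :
  \sum_i w i = 1 -> \sum_j w' j = 1 ->
  \sum_(k : 'I_n * 'I_m) w k.1 * w' k.2 = 1.
Proof.
move=> w1 w1'; rewrite -(pair_bigA _ (fun i j => w i * w' j)) /=.
by under eq_bigr do rewrite -mulr_sumr w1' mulr1.
Qed.

Lemma convex_hull_row_mx A B :
  convex_hull (set_row_mx A B) = set_row_mx (convex_hull A) (convex_hull B).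
Proof.
apply/seteqP; split=> z.
  move=> [n [w [p [pAB w0 w1 ->]]]]; split; rewrite linear_sum.
    exists n, w, (fun i => lsubmx (p i)).
    split=> // [i|]; first by case: (pAB i).
    by apply: eq_bigr => i _; rewrite linearZ.
  exists n, w, (fun i => rsubmx (p i)).
  split=> // [i|]; first by case: (pAB i).
  by apply: eq_bigr => i _; rewrite linearZ.
rewrite -[z]hsubmxK => /set_row_mxE[].
move=> [n [w [p [pA w0 w1 ->]]]] [m [w' [q [qB w0' w1' ->]]]].
rewrite row_mx_sum //; apply: convex_hull_fin => [k|k|].
- exact/set_row_mxE.
- exact: mulr_ge0.
- exact: sum_weights.
Qed.

Lemma affine_hull_row_mx A B :
  affine_hull (set_row_mx A B) = set_row_mx (affine_hull A) (affine_hull B).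
Proof.
apply/seteqP; split=> z.
  move=> [n [w [p [pAB w1 ->]]]]; split; rewrite linear_sum.
    exists n, w, (fun i => lsubmx (p i)).
    split=> // [i|]; first by case: (pAB i).
    by apply: eq_bigr => i _; rewrite linearZ.
  exists n, w, (fun i => rsubmx (p i)).
  split=> // [i|]; first by case: (pAB i).
  by apply: eq_bigr => i _; rewrite linearZ.
rewrite -[z]hsubmxK => /set_row_mxE[].
move=> [n [w [p [pA w1 ->]]]] [m [w' [q [qB w1' ->]]]].
rewrite row_mx_sum //; apply: affine_hull_fin => [k|].
- exact/set_row_mxE.
- exact: sum_weights.
Qed.

Lemma finite_row_mx A B :
  finite_set A -> finite_set B -> finite_set (set_row_mx A B).
Proof.
move=> finA finB.
apply: (@sub_finite_set _ _ ((fun k => row_mx k.1 k.2) @` (A `*` B))).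
  by move=> z [Az Bz]; exists (lsubmx z, rsubmx z) => //=; rewrite hsubmxK.
exact/finite_image/finite_setX.
Qed.

Lemma has_dim_row_mx P Q d e : has_dim P d -> has_dim Q e ->
  has_dim (set_row_mx P Q) (d + e).
Proof.
move=> [x [U [defP dimU]]] [y [V [defQ dimV]]].
pose i1 : 'Hom('rV[R]_N, 'rV[R]_(N + M)) := linfun (mulmxr (row_mx 1%:M 0)).
pose i2 : 'Hom('rV[R]_M, 'rV[R]_(N + M)) := linfun (mulmxr (row_mx 0 1%:M)).
have i1E u : i1 u = row_mx u 0 by rewrite lfunE /= mul_mx_row mulmx1 mulmx0.
have i2E v : i2 v = row_mx 0 v by rewrite lfunE /= mul_mx_row mulmx1 mulmx0.
have mem12 z :
    (z \in i1 @: U + i2 @: V)%VS = (lsubmx z \in U) && (rsubmx z \in V).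
  apply/memv_addP/andP => [|[zU zV]].
    move=> [_ /memv_imgP[u uU ->] [_ /memv_imgP[v vV ->] ->]].
    by rewrite i1E i2E add_row_mx addr0 add0r row_mxKl row_mxKr.
  exists (i1 (lsubmx z)); first exact: memv_img.
  exists (i2 (rsubmx z)); first exact: memv_img.
  by rewrite i1E i2E add_row_mx addr0 add0r hsubmxK.
exists (row_mx x y), (i1 @: U + i2 @: V)%VS; split.
  rewrite affine_hull_row_mx defP defQ; apply/seteqP; split=> z /=.
    by case=> zU zV; rewrite mem12 !linearB /= row_mxKl row_mxKr zU.
  by rewrite mem12 !linearB /= row_mxKl row_mxKr => /andP.
rewrite dimv_disjoint_sum ?limg_dim_eq ?dimU ?dimV //.
- apply/eqP; rewrite -subv0; apply/subvP => v.
  rewrite memv_cap memv_ker i2E memv0.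
  by case/andP=> _ /eqP /(congr1 rsubmx); rewrite row_mxKr linear0 => ->.
- apply/eqP; rewrite -subv0; apply/subvP => v.
  rewrite memv_cap memv_ker i1E memv0.
  by case/andP=> _ /eqP /(congr1 lsubmx); rewrite row_mxKl linear0 => ->.
apply/eqP; rewrite -subv0; apply/subvP => z; rewrite memv_cap memv0.
case/andP=> /memv_imgP[u _ ->] /memv_imgP[v _].
rewrite i1E i2E => /(congr1 lsubmx).
by rewrite !row_mxKl => ->; rewrite row_mx0.
Qed.

Lemma face_row_mx P Q F E : is_face P F -> is_face Q E ->
  is_face (set_row_mx P Q) (set_row_mx F E).
Proof.
move=> /face_le[a [c [va ->]]] /face_le[b [e [vb ->]]].
exists (col_mx a b), (c + e); split=> [z [Pz Qz]|]; rewrite -?/(dot _ _).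
  by rewrite dot_col_mx lerD ?va ?vb.
apply/seteqP; split=> z /=; rewrite -/(dot _ _) dot_col_mx.
  by move=> [[? ->] [? ->]].
move=> [[Pz Qz] E']; have := va _ Pz; have := vb _ Qz => h1 h2.
by split; split=> //; lra.
Qed.

(** Moving only one coordinate block of [z] at a time shows that each block of
    the functional attains its own maximum at [z]. *)
Lemma face_row_mx_inv P Q K z : is_face (set_row_mx P Q) K -> K z ->
  exists F E, [/\ is_face P F, is_face Q E & K = set_row_mx F E].
Proof.
move=> /face_le[a [c [valid ->]]] [[Pz Qz] az].
rewrite -[a]vsubmxK dot_col_mx in az valid *.
set a1 := usubmx a in az valid *; set a2 := dsubmx a in az valid *.
have v1 x : P x -> dot a1 x <= dot a1 (lsubmx z).
  move=> Px; have := valid (row_mx x (rsubmx z)).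
  rewrite dot_col_mx row_mxKl row_mxKr set_row_mxE -az.
  by move=> /(_ (conj Px Qz)); lra.
have v2 y : Q y -> dot a2 y <= dot a2 (rsubmx z).
  move=> Qy; have := valid (row_mx (lsubmx z) y).
  rewrite dot_col_mx row_mxKl row_mxKr set_row_mxE -az.
  by move=> /(_ (conj Pz Qy)); lra.
exists [set x | P x /\ dot a1 x = dot a1 (lsubmx z)].
exists [set y | Q y /\ dot a2 y = dot a2 (rsubmx z)]; split.
- by exists a1, (dot a1 (lsubmx z)).
- by exists a2, (dot a2 (rsubmx z)).
apply/seteqP; split=> t /=; rewrite dot_col_mx -az.
  move=> [[Pt Qt] e]; have := v1 _ Pt; have := v2 _ Qt => h1 h2.
  by split; split=> //; lra.
by move=> [[? ->] [? ->]].
Qed.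

Lemma vertex_row_mx P Q x y :
  is_vertex (set_row_mx P Q) (row_mx x y) <-> is_vertex P x /\ is_vertex Q y.
Proof.
split=> [V|[Vx Vy]].
  have [F [E [fF fE FE]]] :=
    face_row_mx_inv V (erefl : [set row_mx x y] (row_mx x y)).
  have [Fx Ey] : F x /\ E y by apply/set_row_mxE; rewrite -FE.
  have Fset : F = [set x].
    apply/seteqP; split=> [u Fu|_ -> //].
    have : set_row_mx F E (row_mx u y) by apply/set_row_mxE.
    by rewrite -FE => /eq_row_mx[].
  have Eset : E = [set y].
    apply/seteqP; split=> [u Eu|_ -> //].
    have : set_row_mx F E (row_mx x u) by apply/set_row_mxE.
    by rewrite -FE => /eq_row_mx[].
  by rewrite /is_vertex -Fset -Eset.
rewrite /is_vertex (_ : [set row_mx x y] = set_row_mx [set x] [set y]).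
  exact: face_row_mx.
apply/seteqP; split=> z /=; first by move=> ->; apply/set_row_mxE.
by move=> [<- <-]; rewrite hsubmxK.
Qed.

Lemma segment_row_mxr x y y' :
  segment (row_mx x y) (row_mx x y') = set_row_mx [set x] (segment y y').
Proof.
have E t : row_mx x y + t *: (row_mx x y' - row_mx x y)
         = row_mx x (y + t *: (y' - y)).
  by rewrite opp_row_mx add_row_mx scale_row_mx add_row_mx subrr scaler0 addr0.
apply/seteqP; split=> z /=.
  by move=> [t [t01 ->]]; rewrite E; apply/set_row_mxE; split=> //; exists t.
by move=> [zx [t [t01 zy]]]; exists t; rewrite E -zy -zx hsubmxK.
Qed.

Lemma segment_row_mxl x x' y :
  segment (row_mx x y) (row_mx x' y) = set_row_mx (segment x x') [set y].
Proof.
have E t : row_mx x y + t *: (row_mx x' y - row_mx x y)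
         = row_mx (x + t *: (x' - x)) y.
  by rewrite opp_row_mx add_row_mx scale_row_mx add_row_mx subrr scaler0 addr0.
apply/seteqP; split=> z /=.
  by move=> [t [t01 ->]]; rewrite E; apply/set_row_mxE; split=> //; exists t.
by move=> [[t [t01 zx]] zy]; exists t; rewrite E -zy -zx hsubmxK.
Qed.

(** An edge from (x, y) to (x', y') is a product of two faces, hence contains
    (x, y'); on a segment with [x <> x'] this forces [y = y']. *)
Lemma edge_joins_row_mx A B x x' y y'
    (P := convex_hull A) (Q := convex_hull B) :
  is_vertex P x -> is_vertex P x' -> is_vertex Q y -> is_vertex Q y' ->
  edge_joins (set_row_mx P Q) (row_mx x y) (row_mx x' y') <->
  (x = x' /\ edge_joins Q y y') \/ (y = y' /\ edge_joins P x x').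
Proof.
move=> Vx Vx' Vy Vy'.
rewrite -convex_hull_row_mx edge_joinsE convex_hull_row_mx -/P -/Q.
split=> [[_ _ ne fs]|].
  have [F [E [fF fE FE]]] := face_row_mx_inv fs (segment_l _ _).
  have [Fx Ey] : F x /\ E y by apply/set_row_mxE; rewrite -FE; apply: segment_l.
  have [Fx' Ey'] : F x' /\ E y'.
    by apply/set_row_mxE; rewrite -FE; apply: segment_r.
  have [exx|nexx] := eqVneq x x'.
    left; split=> //; apply/edge_joinsE; split=> //.
      by move=> eyy; apply: ne; rewrite exx eyy.
    suff <- : E = segment y y' by [].
    rewrite -exx segment_row_mxr in FE; apply/seteqP; split=> u.
      move=> Eu; have : set_row_mx F E (row_mx x u) by apply/set_row_mxE.
      by rewrite -FE => /set_row_mxE[].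
    move=> su; have : set_row_mx [set x] (segment y y') (row_mx x u).
      exact/set_row_mxE.
    by rewrite FE => /set_row_mxE[].
  have eyy : y = y'.
    have : set_row_mx F E (row_mx x y') by apply/set_row_mxE.
    rewrite -FE => -[t [_]].
    rewrite opp_row_mx add_row_mx scale_row_mx add_row_mx => /eq_row_mx[/eqP].
    rewrite -{1}[x]addr0 (inj_eq (addrI x)) eq_sym scaler_eq0 subr_eq0.
    by rewrite (eq_sym x') (negPf nexx) orbF => /eqP ->; rewrite scale0r addr0.
  right; split=> //; apply/edge_joinsE; split=> //; first exact/eqP.
  suff <- : F = segment x x' by [].
  rewrite -eyy segment_row_mxl in FE; apply/seteqP; split=> u.
    move=> Fu; have : set_row_mx F E (row_mx u y) by apply/set_row_mxE.
    by rewrite -FE => /set_row_mxE[].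
  move=> su; have : set_row_mx (segment x x') [set y] (row_mx u y).
    exact/set_row_mxE.
  by rewrite FE => /set_row_mxE[].
case=> [[<- /edge_joinsE[_ _ ne fs]]|[<- /edge_joinsE[_ _ ne fs]]].
  split; [exact/vertex_row_mx|exact/vertex_row_mx|by move=> /eq_row_mx[]|].
  by rewrite segment_row_mxr; apply: face_row_mx.
split; [exact/vertex_row_mx|exact/vertex_row_mx|by move=> /eq_row_mx[]|].
by rewrite segment_row_mxl; apply: face_row_mx.
Qed.

End Products.

Lemma simply_polytopal_cprod (R : realType) (G H : sgraph) :
  simply_polytopal R G -> simply_polytopal R H ->
  simply_polytopal R (cprod G H).
Proof.
move=> [d [N [P [simP [f [fv fe]]]]]] [e [M [Q [simQ [g [gv ge]]]]]].
have degG := simple_polytope_degree simP fv fe.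
have degH := simple_polytope_degree simQ gv ge.
have [[[A [finA defP]] dimP] _] := simP.
have [[[B [finB defQ]] dimQ] _] := simQ.
pose h (x : cprod G H) := row_mx (f x.1) (g x.2).
have defPQ : set_row_mx P Q = convex_hull (set_row_mx A B).
  by rewrite convex_hull_row_mx defP defQ.
have finAB := finite_row_mx finA finB.
have h_vertices :
    set_bij [set: cprod G H] [set v | is_vertex (set_row_mx P Q) v] h.
  split=> [x _|x y _ _|z /=].
  - by apply/vertex_row_mx; split; apply: vertex_f.
  - case: x y => [a b] [a' b'] /eq_row_mx[/(f_inj fv) /= -> /(f_inj gv) /= ->].
    by [].
  rewrite -[z]hsubmxK => /vertex_row_mx[/(f_surj fv)[a ->] /(f_surj gv)[b ->]].
  by exists (a, b).
have h_edges (x y : cprod G H) :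
    gadj x y <-> edge_joins (set_row_mx P Q) (h x) (h y).
  rewrite /h defP defQ edge_joins_row_mx -?defP -?defQ; try exact: vertex_f.
  rewrite -fe -ge; split.
    by case/orP => /andP[/eqP -> ->]; [left | right].
  rewrite /= /cprod_adj => -[[/(f_inj fv) -> ->]|[/(f_inj gv) -> ->]].
    by rewrite eqxx.
  by rewrite eqxx orbT.
exists (d + e)%N, (N + M)%N, (set_row_mx P Q); split; last by exists h.
split; first by split; [exists (set_row_mx A B) | exact: has_dim_row_mx].
move=> v /(f_surj h_vertices)[[a b] ->].
have := card_edges_at finAB defPQ h_vertices h_edges (a, b).
by rewrite card_nbrs_cprod degG degH.
Qed.

Theorem theorem2p3 (R : realType) (G H : sgraph) :
  simply_polytopal R (cprod G H) <->
  simply_polytopal R G /\ simply_polytopal R H.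
Proof.
split=> [pGH|[pG pH]]; last exact: simply_polytopal_cprod.
split; first exact: (simply_polytopal_cprodl pGH).
exact: (simply_polytopal_cprodl (simply_polytopal_cprodC pGH)).
Qed.
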